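(* Let $X$ be a length space. Suppose $u:X\to\mathbb{R}$ is a Lipschitz map, and there is a constant $C\in(0,\infty)$ such that for every interval $I\subset\mathbb{R}$, each connected component of $u^{-1}(I)$ has diameter at most $C\cdot\operatorname{diam}(I)$. Then $X$ admits a bilipschitz embedding $f:X\to L_1(Z,\mu)$ for some measure space $(Z,\mu)$.
   Context: A length space is a metric space in which the distance between any two points is the infimum of the lengths of paths joining them. A map $f:X\to Y$ between metric spaces is a bilipschitz embedding if there is $L\in[1,\infty)$ with $L^{-1}d(x,x')\le d(f(x),f(x'))\le L\,d(x,x')$ for all $x,x'\in X$. For an unbounded interval $I$ we have $\operatorname{diam}(I)=\infty$ and the condition is vacuous. *)

(* Defs.v *)
From HB Require Import structures.
From mathcomp Require Import all_boot all_order all_algebra.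
From mathcomp Require Import all_classical all_reals all_analysis measurable_realfun.

Set Implicit Arguments.
Unset Strict Implicit.
Unset Printing Implicit Defensive.

Import Order.TTheory GRing.Theory Num.Theory.
Import numFieldNormedType.Exports.

Local Open Scope classical_set_scope.
Local Open Scope ring_scope.

Section metric_notions.
Context {R : realType}.

(* The supremum is taken in \bar R, so the diameter of an unbounded set is +oo;
   that of set0 is -oo. *)
Definition diam {X : metricType R} (A : set X) : \bar R :=
  ereal_sup [set (mdist p.1 p.2)%:E | p in A `*` A].

(* mathcomp-analysis puts the metric |x - y| of the real line on R^o, so a
   real-valued function is typed X -> R^o when it is an argument here. *)
Definition lipschitz_map {X Y : metricType R} (f : X -> Y) : Prop :=
  exists2 K : R, 0 <= K & forall x x', mdist (f x) (f x') <= K * mdist x x'.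

Definition bilipschitz_embedding {X Y : metricType R} (f : X -> Y) : Prop :=
  exists2 L : R, 1 <= L & forall x x',
    L^-1 * mdist x x' <= mdist (f x) (f x') <= L * mdist x x'.

(* Same indexing as [variation] in numfun.v: s lists the points of a
   subdivision of [0, 1] other than 0. *)
Definition polygonal_length {X : metricType R} (g : R -> X) (s : seq R) : R :=
  let G := g \o nth 1 (0 :: s) in
  \sum_(0 <= i < size s) mdist (G i) (G i.+1).

Definition path_length {X : metricType R} (g : R -> X) : \bar R :=
  ereal_sup [set (polygonal_length g s)%:E | s in itv_partition 0 1].

(* Only the values on [0, 1] matter. *)
Definition is_path {X : metricType R} (x y : X) (g : R -> X) : Prop :=
  [/\ {within `[0, 1], continuous g}, g 0 = x & g 1 = y].

(* The infimum of the empty set is +oo, so any two points of a length space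
   are joined by a path of finite length. *)
Definition length_space (X : metricType R) : Prop :=
  forall x y : X, (mdist x y)%:E = ereal_inf (path_length @` is_path x y).

End metric_notions.

Section L1_metric.
Context d (Z : measurableType d) (R : realType).
Variable mu : {measure set Z -> \bar R}.
Implicit Types f g h : LspaceType1 mu.

(* The elements of [LspaceType1 mu] are a.e.-classes; [f] used as a function is
   a chosen representative, and the L1 norm does not depend on the choice. *)
Definition L1_dist f g : R := fine ('N[mu]_1[EFin \o (f \- g)%R])%E.

Let L1_meas f : measurable_fun [set: Z] (f : Z -> R).
Proof. exact: (measurable_funPT (repr (LebesgueSpace.sort f))). Qed.

Let L1_lty f : ('N[mu]_1[EFin \o f] < +oo)%E.
Proof. exact: Lebesgue_finite. Qed.

Let L1_distE f g : (L1_dist f g)%:E = 'N[mu]_1[EFin \o (f \- g)%R]%E.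
Proof.
rewrite fineK// ge0_fin_numE ?Lnorm_ge0//.
have -> : (f \- g)%R = (f \+ (\- g))%R :> (Z -> R) by [].
have mN : measurable_fun [set: Z] (\- (g : Z -> R)) by exact: measurableT_comp.
apply: le_lt_trans (minkowski_EFin _ (L1_meas f) mN (lexx _)) _.
rewrite lte_add_pinfty//.
have -> : EFin \o (\- (g : Z -> R)) = (\- (EFin \o g))%E by [].
by rewrite oppe_Lnorm.
Qed.

Let L1_dist0 f : L1_dist f f = 0.
Proof.
apply: EFin_inj; rewrite L1_distE Lnorm1 integral0_eq// => x _ /=.
by rewrite subrr normr0.
Qed.

Let L1_sym f g : L1_dist f g = L1_dist g f.
Proof.
apply: EFin_inj; rewrite !L1_distE !Lnorm1.
by apply: eq_integral => x _ /=; rewrite distrC.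
Qed.

Let L1_triangle g f h : L1_dist f h <= L1_dist f g + L1_dist g h.
Proof.
rewrite -lee_fin EFinD !L1_distE.
have -> : (f \- h)%R = ((f \- g) \+ (g \- h))%R :> (Z -> R).
  by apply/funext => x /=; rewrite addrA subrK.
by apply: minkowski_EFin => //; exact: measurable_funB.
Qed.

Let L1_eq f g : L1_dist f g = 0 -> f = g.
Proof.
move=> fg0.
have fg : (f : Z -> R) = g %[ae mu].
  have mfg : measurable_fun [set: Z] (EFin \o (f \- g)).
    exact/measurable_EFinP/measurable_funB.
  have /(Lnorm_eq0_eq0 mfg lte01) : 'N[mu]_1[EFin \o (f \- g)%R]%E = 0%E.
    by rewrite -L1_distE fg0.
  apply: filterS => x /= /(_ I) [] fgx _.
  by apply/eqP; rewrite -subr_eq0; apply/eqP.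
have : LebesgueSpace.sort f = LebesgueSpace.sort g.
  by rewrite -[LHS]reprK -[RHS]reprK; apply/eqmodP/asboolP.
case: f g {fg0 fg} => [f [[ff]]] [g [[gf]]] /= fg; rewrite -fg in gf *.
by rewrite (Prop_irrelevance ff gf).
Qed.

HB.instance Definition _ := gen_eqMixin (LspaceType1 mu).
HB.instance Definition _ := gen_choiceMixin (LspaceType1 mu).
HB.instance Definition _ := isMetric.Build R (LspaceType1 mu)
  L1_dist0 L1_eq L1_sym L1_triangle.

Lemma mdist_L1E f g : mdist f g = L1_dist f g.
Proof. by []. Qed.

End L1_metric.

(* Main.v *)
From HB Require Import structures.
From mathcomp Require Import all_boot all_order all_algebra.
From mathcomp Require Import all_classical all_reals all_analysis measurable_realfun.
From mathcomp Require Import ring lra zify.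
Require Import Defs.

(** The hypothesis makes the distance of [x] and [y] comparable with the length
    of the shortest interval whose preimage under [u] has a component containing
    both points: the length space property and the Lipschitz bound give one
    inequality, the bound on the diameters of components gives the other. To
    embed [X] it is therefore enough to measure, for every scale [4^-j], whether
    [x] and [y] lie in the same component over a cell of a 4-adic grid of the
    line.

    This is done by a random function on [X], a multiplicative cascade, whose
    distribution supplies the measure space. Every component of every scale owns
    an independent fair coin. Starting from [u], the slope of the function with
    respect to [u] is multiplied on each component by [1 + 1/2] on one half of
    its cell and by [1 - 1/2] on the other half, and the coin decides which half
    is the steep one. In other words, a random multiple of a tent function of
    [u] is added. The tent vanishes at both ends of the cell, so that the result
    is well defined however the components are glued to each other.

    Upper bound. On a component of the finest scale the cascade is an affine
    function of [u] with slope a product of factors of mean one. The slope is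
    positive, so that its mean absolute value is one although the slope itself
    is unbounded, and the mean oscillation of the cascade is locally at most a
    constant times the distance ([cascade_local], [mean_density]). In a length
    space a local Lipschitz bound is a global one ([locally_lipschitz]).

    Lower bound. If [x] and [y] lie in different components of scale [4^-j], then
    the correlation of the difference of the values at [x] and [y] with the coin
    of the component of [x] is exactly the height of the tent at [u x]
    ([mean_cascade_sign]), hence this height bounds the mean absolute difference
    from below. The height is comparable with [4^-j] unless [u x] is close to a
    division point; this cannot happen in both of two grids that differ by a
    third of a cell at every scale ([tent_large]), and one additional coin
    decides which of the two grids is used.

    The scales range over all integers. At small scales there is uniform
    convergence, because tents shrink by the factor 4 while slopes grow at most
    by the factor [3/2]. At large scales the cascade has to be renormalized: it
    is divided by the slope of the components that contain a base point, after
    which the cascades started at two different large scales agree on every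
    component of the base point on which both are defined ([stage_shift]). The
    coins of these components are biased so as to compensate for the division
    ([mean_sign0]).

    There may be uncountably many components, so that the product measure is
    needed for arbitrarily many coins. It is obtained by extending the obvious
    content on cylinders, which is countably additive because cylinders are
    clopen in a compact space ([cylinder_partition_finite]). All estimates
    concern functions of finitely many coins, whose integrals are finite
    averages ([integral_cylindrical]). *)

Set Implicit Arguments.
Unset Strict Implicit.
Unset Printing Implicit Defensive.

Import Order.TTheory GRing.Theory Num.Theory.
Import numFieldNormedType.Exports.

Local Open Scope classical_set_scope.
Local Open Scope ring_scope.

(** * Averages of functions of finitely many coins *)

Section finite_dependence.
Context {K : choiceType}.
Implicit Types (w : K -> bool) (k l : K) (s t : seq K).

Definition upd w k b : K -> bool := fun l => if l == k then b else w l.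

Definition depends_on {T} s (g : (K -> bool) -> T) :=
  forall w w', {in s, w =1 w'} -> g w = g w'.

Definition cylindrical {T} (g : (K -> bool) -> T) := exists s, depends_on s g.

Lemma depends_on_sub {T} s t (g : (K -> bool) -> T) :
  {subset s <= t} -> depends_on s g -> depends_on t g.
Proof. by move=> st sg w w' ww'; apply: sg => k /st; exact: ww'. Qed.

Lemma cylindrical_cst {T} (c : T) : cylindrical (fun=> c).
Proof. by exists [::]. Qed.

Lemma cylindrical_coord k : cylindrical (fun w => w k).
Proof. by exists [:: k] => w w'; apply; rewrite mem_head. Qed.

Lemma cylindrical_comp {T U} (h : T -> U) (g : (K -> bool) -> T) :
  cylindrical g -> cylindrical (fun w => h (g w)).
Proof. by move=> [s sg]; exists s => w w' /sg ->. Qed.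

Lemma cylindrical_comp2 {T1 T2 U} (h : T1 -> T2 -> U)
    (g1 : (K -> bool) -> T1) (g2 : (K -> bool) -> T2) :
  cylindrical g1 -> cylindrical g2 -> cylindrical (fun w => h (g1 w) (g2 w)).
Proof.
move=> [s sg] [t tg]; exists (s ++ t) => w w' ww'.
by congr h; [apply: sg|apply: tg] => k kin; apply: ww'; rewrite mem_cat kin ?orbT.
Qed.

Lemma upd_id w k : upd w k (w k) = w.
Proof. by apply/funext => l; rewrite /upd; case: eqP => // ->. Qed.

Lemma updC w k l b c : k != l -> upd (upd w k b) l c = upd (upd w l c) k b.
Proof.
move=> kl; apply/funext => m; rewrite /upd.
by case: eqP => // ->; rewrite eq_sym (negbTE kl).
Qed.

Lemma depends_on_upd {T} s (g : (K -> bool) -> T) k b :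
  depends_on s g -> depends_on [seq l <- s | l != k] (fun w => g (upd w k b)).
Proof.
move=> sg w w' ww'; apply: sg => l ls; rewrite /upd; case: eqP => // /eqP lk.
by apply: ww'; rewrite mem_filter lk.
Qed.

Section mean.
Context {R : realType} (p : K -> R).
Implicit Types (g h : (K -> bool) -> R).

(** The average over one coin is an operator on functions of all coins, so that
    the expectation of a function of finitely many coins can be computed one coin
    at a time and in any order. *)
Definition avg k g : (K -> bool) -> R :=
  fun w => p k * g (upd w k true) + (1 - p k) * g (upd w k false).

Definition avgs s g := foldr avg g s.

(** The expectation of [g] when the coin [k] shows [true] with probability
    [p k]. The list of coins and the configuration are immaterial, see [meanE].
    The value is meaningful only if [g] is cylindrical. *)
Definition mean g : R := avgs (xget [::] [set s | depends_on s g]) g (fun=> true).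

Lemma depends_on_avg s g k :
  depends_on s g -> depends_on [seq l <- s | l != k] (avg k g).
Proof.
by move=> sg w w' ww'; congr (_ * _ + _ * _); apply: depends_on_upd ww'.
Qed.

Lemma avg_indep s g k : depends_on s g -> k \notin s -> avg k g = g.
Proof.
move=> sg ks; apply/funext => w; rewrite /avg.
have gw b : g (upd w k b) = g w.
  by apply: sg => l ls; rewrite /upd; case: eqP => // lk; rewrite -lk ls in ks.
by rewrite !gw; ring.
Qed.

Lemma avgC k l g : avg k (avg l g) = avg l (avg k g).
Proof.
have [->//|kl] := eqVneq k l.
apply/funext => w; rewrite /avg !(updC _ _ _ kl); ring.
Qed.

Lemma depends_on_avgs s t g :
  depends_on s g -> depends_on [seq l <- s | l \notin t] (avgs t g).
Proof.
move=> sg; elim: t => [|k t ih] /=.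
  by apply: depends_on_sub sg => l; rewrite mem_filter.
apply: depends_on_sub (depends_on_avg (k := k) ih) => l.
by rewrite !mem_filter inE negb_or -andbA.
Qed.

Lemma avgs_indep t g : depends_on [::] g -> avgs t g = g.
Proof. by move=> g0; elim: t => //= k t ->; exact: avg_indep g0 _. Qed.

Lemma avg_avgs k t g : avg k (avgs t g) = avgs t (avg k g).
Proof. by elim: t => //= l t <-; exact: avgC. Qed.

Lemma avgs_avgs s t g : avgs s (avgs t g) = avgs t (avgs s g).
Proof. by elim: s => //= k s ->; exact: avg_avgs. Qed.

Lemma depends_on_avgs_nil s g : depends_on s g -> depends_on [::] (avgs s g).
Proof.
move=> sg; apply: depends_on_sub (depends_on_avgs (t := s) sg) => l.
by rewrite mem_filter andNb.
Qed.

(** Two lists on which [g] depends give the same constant: averaging over both of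
    them changes neither constant, and the order of averaging is immaterial. *)
Lemma meanE s g w : depends_on s g -> mean g = avgs s g w.
Proof.
move=> sg; rewrite /mean; case: xgetP => [t _ /= tg|/(_ s)//].
have -> : avgs t g = avgs s g.
  rewrite -(avgs_indep s (depends_on_avgs_nil tg)).
  by rewrite avgs_avgs; exact/avgs_indep/depends_on_avgs_nil.
exact: depends_on_avgs_nil.
Qed.

Lemma mean_avg k g : cylindrical g -> mean (avg k g) = mean g.
Proof.
move=> [s sg]; rewrite (meanE (fun=> true) sg).
have sg' : depends_on s (avg k g).
  apply: depends_on_sub (depends_on_avg (k := k) sg) => l.
  by rewrite mem_filter => /andP[].
rewrite (meanE (fun=> true) sg') -avg_avgs.
by rewrite (avg_indep (depends_on_avgs_nil sg)).
Qed.

Lemma mean_cst (c : R) : mean (fun=> c) = c.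
Proof. by rewrite (@meanE [::] _ (fun=> true)). Qed.

Lemma meanD g h : cylindrical g -> cylindrical h ->
  mean (fun w => g w + h w) = mean g + mean h.
Proof.
move=> [s sg] [t th].
have sg' : depends_on (s ++ t) g.
  by apply: depends_on_sub sg => k; rewrite mem_cat => ->.
have th' : depends_on (s ++ t) h.
  by apply: depends_on_sub th => k; rewrite mem_cat orbC => ->.
rewrite (meanE (fun=> true) sg') (meanE (fun=> true) th').
rewrite (@meanE (s ++ t) _ (fun=> true)); last first.
  by move=> w w' ww'; congr (_ + _); [exact: sg'|exact: th'].
elim: (s ++ t) (fun=> true) => //= k r ih w; rewrite /avg !ih; ring.
Qed.

Lemma meanZ c g : cylindrical g -> mean (fun w => c * g w) = c * mean g.
Proof.
move=> [s sg]; rewrite (meanE (fun=> true) sg).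
rewrite (@meanE s _ (fun=> true)); last by move=> w w' /sg ->.
elim: s {sg} (fun=> true) => //= k r ih w; rewrite /avg !ih; ring.
Qed.

Lemma meanB g h : cylindrical g -> cylindrical h ->
  mean (fun w => g w - h w) = mean g - mean h.
Proof.
move=> cg ch; under eq_fun do rewrite -(mulN1r (h _)).
rewrite meanD ?meanZ ?mulN1r//; exact: cylindrical_comp.
Qed.

Hypothesis p01 : forall k, 0 <= p k <= 1.

Lemma le_mean g h : cylindrical g -> cylindrical h ->
  (forall w, g w <= h w) -> mean g <= mean h.
Proof.
move=> cg ch gh; rewrite -subr_ge0 -meanB//.
have [s sgh] : cylindrical (fun w => h w - g w).
  exact: (cylindrical_comp2 (fun a b => a - b)).
rewrite (meanE (fun=> true) sgh).
have f0 w : 0 <= h w - g w by rewrite subr_ge0.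
elim: s {sgh} (fun=> true) => //= k s ih w.
have /andP[p0 p1] := p01 k.
by apply: addr_ge0; apply: mulr_ge0; rewrite ?subr_ge0//; exact: ih.
Qed.

Lemma mean_ge0 g : cylindrical g -> (forall w, 0 <= g w) -> 0 <= mean g.
Proof.
by move=> cg g0; rewrite -(mean_cst 0); exact: le_mean (cylindrical_cst _) cg g0.
Qed.

End mean.
End finite_dependence.

(** * The product measure on configurations of coins *)

Section cylinders.
Context {K : choiceType}.

Definition coins : Type := K -> bool.
HB.instance Definition _ := Pointed.on coins.

Lemma cylindrical0 : cylindrical (set0 : set coins).
Proof. exact: cylindrical_cst. Qed.

Lemma cylindricalU (A B : set coins) :
  cylindrical A -> cylindrical B -> cylindrical (A `|` B).
Proof. exact: (cylindrical_comp2 or). Qed.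

Lemma cylindricalC (A : set coins) : cylindrical A -> cylindrical (~` A).
Proof. exact: (cylindrical_comp not). Qed.

Fact cylinder_display : measure_display. Proof. exact. Qed.

HB.instance Definition _ := @isAlgebraOfSets.Build cylinder_display coins
  (@cylindrical K Prop) cylindrical0 cylindricalU cylindricalC.

Lemma cylindrical_open (A : set coins) :
  cylindrical A -> open (A : set (prod_topology (fun _ : K => bool))).
Proof.
move=> [s sA]; rewrite openE => w Aw.
have : nbhs (w : prod_topology (fun _ : K => bool)) [set w' | {in s, w =1 w'}].
  elim: s {sA} => [|k s ih]; first by apply: filterS (@filterT _ _ _) => w' _ k.
  have kw : \forall w' \near (w : prod_topology (fun _ : K => bool)), w' k = w k.
    have := @proj_continuous _ (fun _ : K => bool) k w.
    by move=> /(_ [set w k]); apply; exact: discrete_set1.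
  apply: filterS2 kw ih => w' w'k ih l; rewrite inE => /predU1P[->//|]; exact: ih.
by apply: filterS => w' /sA <-.
Qed.

(** Cylinders are clopen in the product topology, which is compact: a countable
    disjoint union of cylinders that is a cylinder has finitely many nonempty
    members. *)
Lemma cylinder_partition_finite (F : (set coins)^nat) :
  (forall i, cylindrical (F i)) -> trivIset setT F ->
  cylindrical (\bigcup_i F i) -> exists n, forall i, (n <= i)%N -> F i = set0.
Proof.
move=> mF tF mU; pose T := prod_topology (fun _ : K => bool).
have cT : compact [set: T].
  have := @tychonoff _ (fun _ : K => bool) _ (fun=> bool_compact).
  by congr (compact _); rewrite eqEsubset.
have cU : compact (\bigcup_i F i : set T).
  apply: subclosed_compact cT _ => //.
  rewrite -[X in closed X]setCK closedC; exact/cylindrical_open/cylindricalC.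
have := (compact_near_coveringP _).1 cU nat \oo
  (fun n w => exists2 i, (i < n)%N & F i w).
case=> [w [i _ Fiw]|n _ Fn].
  exists (F i, [set n | (i < n)%N]); last by case=> w' n [/= Fiw' ni]; exists i.
  split; last by exists i.+1.
  have /= := @open_nbhs_nbhs T w (F i); apply; split=> //.
  exact: (cylindrical_open (mF i)).
exists n => i ni; rewrite -subset0 => w Fiw.
have [|j jn Fjw] := Fn n (leqnn n) w; first by exists i.
have ij : i = j by apply: (tF i j) => //; exists w.
by move: jn; rewrite -ij ltnNge ni.
Qed.

Section bernoulli.
Context {R : realType} (p : K -> R).
Hypothesis p01 : forall k, 0 <= p k <= 1.

Definition cylinder_measure (A : set coins) : \bar R := (mean p (\1_A))%:E.

Lemma cylindrical_indic (A : set coins) :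
  cylindrical A -> cylindrical (\1_A : coins -> R).
Proof.
move=> [s sA]; exists s => w w' ww'; rewrite !indicE.
by congr (nat_of_bool _)%:R; apply/idP/idP; rewrite !inE; rewrite (sA _ _ ww').
Qed.

Let cylinder_measure0 : cylinder_measure set0 = 0%E.
Proof. by rewrite /cylinder_measure indic0 mean_cst. Qed.

Let cylinder_measure_ge0 (A : set coins) : (0 <= cylinder_measure A)%E.
Proof.
have [cA|nA] := pselect (cylindrical A).
  by rewrite lee_fin mean_ge0//; exact: cylindrical_indic.
rewrite lee_fin /mean; elim: (xget _ _) (fun=> true) => //= k s ih w.
have /andP[p0 p1] := p01 k.
by apply: addr_ge0; apply: mulr_ge0; rewrite ?subr_ge0//; exact: ih.
Qed.

Let cylinder_measure_additive : semi_sigma_additive cylinder_measure.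
Proof.
move=> F mF tF mU.
have [n Fn] := cylinder_partition_finite mF tF mU.
apply: cvg_near_cst; exists n => // m /= nm.
have -> : \bigcup_i F i = \big[setU/set0]_(i < m) F i.
  rewrite -(bigcup_mkord m F); apply/seteqP.
  split=> [w [i _ Fiw]|w [i _ Fiw]]; exists i => //=.
  by rewrite ltnNge; apply/negP => mi; move: Fiw; rewrite Fn// (leq_trans nm).
rewrite big_mkord; elim: m {nm} => [|m ih].
  by rewrite !big_ord0 cylinder_measure0.
have mFm : forall m, cylindrical (\big[setU/set0]_(i < m) F i).
  elim=> [|j ihj]; first by rewrite big_ord0; exact: cylindrical0.
  by rewrite big_ord_recr; exact: (cylindricalU ihj (mF j)).
rewrite !big_ord_recr/= ih -EFinD -meanD;
  [|exact: cylindrical_indic (mFm _)|exact: cylindrical_indic (mF _)].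
congr (_%:E); congr mean; apply/funext => w.
rewrite !indicE !in_setU.
case: (boolP (w \in F m)) => wm; last by rewrite orbF addr0.
rewrite orbT; case: (boolP (w \in _)) => wU; last by rewrite add0r.
move: wU; rewrite inE -(bigcup_mkord m F) => -[i /= im Fiw].
have : i = m by apply: (tF i m) => //; exists w; split=> //; exact: set_mem.
by move=> eim; rewrite eim ltnn in im.
Qed.

HB.instance Definition _ := isMeasure.Build _ _ _ cylinder_measure
  cylinder_measure0 cylinder_measure_ge0 cylinder_measure_additive.

Definition coin_space := g_sigma_algebraType (@measurable _ coins).

Definition coin_measure : {measure set coin_space -> \bar R} :=
  [the measure _ _ of measure_extension cylinder_measure].

Lemma coin_measureE (A : set coins) :
  cylindrical A -> coin_measure A = (mean p (\1_A))%:E.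
Proof. by move=> cA; rewrite /coin_measure/= /measure_extension measurable_mu_extE. Qed.

Lemma coin_measure_setT : coin_measure setT = 1%E.
Proof. by rewrite coin_measureE ?indicT ?mean_cst//; exact: cylindrical_cst. Qed.

Lemma cylindrical_measurable (A : set coin_space) : cylindrical A -> measurable A.
Proof. by move=> cA; apply: sub_sigma_algebra. Qed.

Lemma cylindrical_measurable_fun (g : coins -> R) :
  cylindrical g -> measurable_fun setT (g : coin_space -> R).
Proof.
move=> cg _ Y _; rewrite setTI; apply: cylindrical_measurable.
exact: (cylindrical_comp Y).
Qed.

(** By induction on the coins on which [g] depends: on the two cylinders given by
    the value of a coin, [g] is a function of the remaining coins. The induction
    needs the integrals over all cylinders. *)
Lemma integral_cylindrical (g : coins -> R) : cylindrical g ->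
  (forall w, 0 <= g w) -> (\int[coin_measure]_w (g w)%:E = (mean p g)%:E)%E.
Proof.
move=> [s sg] g0.
suff /(_ setT (cylindrical_cst _)) -> : forall A : set coins, cylindrical A ->
    (\int[coin_measure]_(w in A) (g w)%:E = (mean p (fun w => \1_A w * g w))%:E)%E.
  by congr (_%:E); congr mean; apply/funext => w; rewrite indicT mul1r.
elim: s g g0 sg => [|k s ih] g g0 sg A cA.
  have gE w : g w = g (fun=> true) by apply: sg.
  under eq_integral do rewrite gE.
  rewrite integral_cst; last exact: cylindrical_measurable.
  rewrite [X in (_ * X)%E]coin_measureE// -EFinM -meanZ; last exact: cylindrical_indic.
  by congr (_%:E); congr mean; apply/funext => w; rewrite [in RHS]gE mulrC.
pose H b := [set w : coins | w k = b].
have cH b : cylindrical (H b).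
  by apply: (cylindrical_comp (fun c => c = b)); exact: cylindrical_coord.
have sgb b : depends_on s (fun w => g (upd w k b)).
  apply: depends_on_sub (depends_on_upd b sg) => l.
  by rewrite mem_filter inE => /andP[/negbTE ->].
have AH : A = (A `&` H true) `|` (A `&` H false).
  rewrite -setIUr [X in _ `&` X](_ : _ = setT) ?setIT//.
  by apply/seteqP; split => // w _; rewrite /H/=; case: (w k); [left|right].
have cAH b : cylindrical (A `&` H b) by exact: (cylindrical_comp2 and).
have intAH b : (\int[coin_measure]_(w in A `&` H b) (g w)%:E =
    (mean p (fun w => \1_(A `&` H b) w * g w))%:E)%E.
  transitivity (\int[coin_measure]_(w in A `&` H b) (g (upd w k b))%:E)%E.
    by apply: eq_integral => w; rewrite inE => -[_ <-]; rewrite upd_id.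
  rewrite ih//; congr (_%:E); congr mean; apply/funext => w; rewrite !indicE.
  case: (boolP (w \in _)); last by rewrite !mul0r.
  by rewrite inE => -[_ <-]; rewrite upd_id.
rewrite [X in (\int[_]_(_ in X) _)%E]AH ge0_integral_setU//=.
- rewrite [X in (X + _)%E]intAH [X in (_ + X)%E]intAH -EFinD -meanD.
  + congr (_%:E); congr mean; apply/funext => w.
    rewrite -mulrDl; congr (_ * _); rewrite !indicE !in_setI.
    rewrite [w \in H true](_ : _ = w k); last by apply/idP/idP; rewrite inE.
    rewrite [w \in H false](_ : _ = ~~ w k); last first.
      by apply/idP/idP; rewrite inE; [move->|move/negbTE].
    by case: (w \in A); case: (w k); rewrite /= ?addr0 ?add0r.
  + apply: (cylindrical_comp2 *%R); first exact: cylindrical_indic.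
    by exists (k :: s).
  + apply: (cylindrical_comp2 *%R); first exact: cylindrical_indic.
    by exists (k :: s).
- exact: cylindrical_measurable.
- exact: cylindrical_measurable.
- apply/measurable_EFinP; apply: measurable_funTS.
  by apply: cylindrical_measurable_fun; exists (k :: s).
- by move=> w _; rewrite lee_fin.
- apply/disj_setPS => w [[_ Ht] [_ Hf]]; by move: Hf; rewrite /H/= Ht.
Qed.

End bernoulli.
End cylinders.

(** * Two families of 4-adic grids on the line *)

Section grids.
Context {R : realType}.
Implicit Types (b : bool) (j m : int) (t c : R).

(** The offsets are the fixed points of multiplication by 4 modulo 1, other than
    0, so that each grid refines the coarser grids of its family. No number is a
    division point at all coarse scales, hence the cells that contain a given
    point exhaust the line. *)
Definition theta b : R := if b then 3^-1 else 2 / 3.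

(** Three times [theta]. *)
Definition shift b : int := if b then 1 else 2.

(** The position of [t] in units of the cell length [4^-j]: the division points
    are the points at which it is an integer. *)
Definition coord b j t : R := 4 ^ j * t - theta b.

Definition cell b j t : int := Num.floor (coord b j t).

(** The derivative of the tent on the cell of [t]. *)
Definition slope b j t : R :=
  if coord b j t - (cell b j t)%:~R < 2^-1 then 2^-1 else - 2^-1.

(** The tent over the [m]-th cell. It is evaluated also at the right end point of
    the cell, which belongs to the next cell. *)
Definition tent b j m c : R :=
  (2 * 4 ^ j)^-1 * Num.min (coord b j c - m%:~R) (m%:~R + 1 - coord b j c).

Definition grid_point b j c := exists k : int, coord b j c = k%:~R.

Lemma exp4_gt0 j : 0 < (4 : R) ^ j.
Proof. exact: exprz_gt0. Qed.

Lemma coordS b j t :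
  coord b (j + 1) t = 4 * coord b j t + (shift b)%:~R.
Proof.
rewrite /coord expfzDr// expr1z mulrAC /theta /shift; set x := _ * t.
by case: b => /=; lra.
Qed.

Lemma cell_itv b j t : (cell b j t)%:~R <= coord b j t < (cell b j t)%:~R + 1.
Proof. by have := floor_itv (coord b j t); rewrite intrD. Qed.

Lemma cell_leS b j t m : m%:~R <= coord b j t ->
  (4 * m + shift b <= cell b (j + 1) t)%R.
Proof.
by move=> mt; rewrite floor_ge_int coordS intrD intrM lerD2r ler_pM2l.
Qed.

Lemma cell_ltS b j t m : coord b j t < m%:~R ->
  (cell b (j + 1) t < 4 * m + shift b)%R.
Proof.
by move=> mt; rewrite floor_lt_int coordS intrD intrM ltrD2r ltr_pM2l.
Qed.

Lemma cell_sub b j t t' :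
  cell b (j + 1) t = cell b (j + 1) t' -> cell b j t = cell b j t'.
Proof.
wlog suff : t t' / cell b (j + 1) t = cell b (j + 1) t' ->
    (cell b j t <= cell b j t')%R.
  by move=> le tt'; apply/eqP; rewrite eq_le !le.
move=> tt'; have /andP[/cell_leS] := cell_itv b j t; rewrite tt' => + _.
have /andP[_] := cell_itv b j t'; rewrite -[1]/(1%:~R) -intrD => /cell_ltS.
by rewrite /shift; case: b {tt'}; lia.
Qed.

Lemma slope_half b j t :
  slope b j t = if (cell b (j + 1) t < 4 * cell b j t + shift b + 2)%R
    then 2^-1 else - 2^-1.
Proof.
rewrite /slope floor_lt_int coordS !intrD intrM.
by congr (if _ then _ else _); apply/idP/idP; lra.
Qed.

Lemma slope_sub b j t t' :
  cell b (j + 1) t = cell b (j + 1) t' -> slope b j t = slope b j t'.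
Proof. by move=> e; rewrite !slope_half e (cell_sub e). Qed.

Lemma slope_bound b j t : - 2^-1 <= slope b j t <= 2^-1.
Proof. by rewrite /slope; case: ifP => _; lra. Qed.

(** The quarter of a cell that contains [t] lies in one of its two halves, on
    which the tent is affine. *)
Lemma tent_affine b j t c :
  (cell b (j + 1) t)%:~R <= coord b (j + 1) c <= (cell b (j + 1) t)%:~R + 1 ->
  tent b j (cell b j t) t - tent b j (cell b j t) c = slope b j t * (t - c).
Proof.
move=> /andP[c1 c2]; have /andP[t1 t2] := cell_itv b (j + 1) t.
have /andP[m1 m2] := cell_itv b j t.
have e0 : (4 : R) ^ j != 0 by rewrite gt_eqF// exp4_gt0.
have tcE : t - c = (4 ^ j)^-1 * (coord b j t - coord b j c).
  by rewrite /coord; field.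
have m4 := cell_leS m1.
have m4' : (cell b (j + 1) t < 4 * (cell b j t + 1) + shift b)%R.
  by apply: cell_ltS; rewrite intrD.
rewrite slope_half /tent; case: ifPn => h.
- have h' : (cell b (j + 1) t + 1 <= 4 * cell b j t + shift b + 2)%R by lia.
  rewrite -(ler_int R) !intrD !intrM in h'; rewrite -(ler_int R) !intrD !intrM in m4.
  rewrite coordS in c1 c2; rewrite coordS in t1 t2.
  rewrite !min_l; [|lra..].
  by rewrite tcE; field.
- have h' : (4 * cell b j t + shift b + 2 <= cell b (j + 1) t)%R by lia.
  have h2 : (cell b (j + 1) t + 1 <= 4 * cell b j t + 4 + shift b)%R by lia.
  rewrite -(ler_int R) !intrD !intrM in h'; rewrite -(ler_int R) !intrD !intrM in h2.
  rewrite coordS in c1 c2; rewrite coordS in t1 t2.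
  rewrite !min_r; [|lra..].
  by rewrite tcE; field.
Qed.

Lemma tent_ge0 b j t : 0 <= tent b j (cell b j t) t.
Proof.
have /andP[t1 t2] := cell_itv b j t.
rewrite mulr_ge0 ?invr_ge0 ?mulr_ge0 ?(ltW (exp4_gt0 _))//.
by rewrite le_min; lra.
Qed.

Lemma tent_le b j t : tent b j (cell b j t) t <= (2 * 4 ^ j)^-1.
Proof.
have /andP[t1 t2] := cell_itv b j t.
rewrite ler_piMr ?invr_ge0 ?mulr_ge0 ?(ltW (exp4_gt0 _))//.
by rewrite ge_min; lra.
Qed.

(** The division points of the two grids of a given scale are a third of a cell
    apart, so that every point has distance at least a sixth of a cell from the
    division points of one of the grids. *)
Lemma tent_large j t : exists b, (12 * 4 ^ j)^-1 <= tent b j (cell b j t) t.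
Proof.
suff [b [h1 h2]] : exists b, (cell b j t)%:~R + 6^-1 <= coord b j t /\
    coord b j t <= (cell b j t)%:~R + 1 - 6^-1.
  exists b; rewrite /tent (_ : 12 * 4 ^ j = 2 * 4 ^ j * 6); last by ring.
  rewrite invfM ler_pM2l ?invr_gt0 ?mulr_gt0 ?exp4_gt0//.
  by rewrite le_min; lra.
have /andP[t1 t2] := cell_itv true j t.
have /andP[f1 f2] := cell_itv false j t.
have ft : coord false j t = coord true j t - 3^-1 by rewrite /coord /theta; lra.
set m := cell true j t in t1 t2 *; set m' := cell false j t in f1 f2 *.
have : (m' = m \/ m' = m - 1)%R.
  have : (m' < m + 1)%R by rewrite -(ltr_int R) intrD; lra.
  have : (m - 1 - 1 < m')%R by rewrite -(ltr_int R) !intrB; lra.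
  by lia.
have [h1|h1] := leP (m%:~R + 6^-1) (coord true j t).
  have [h2|h2] := leP (coord true j t) (m%:~R + 1 - 6^-1); first by exists true.
  case=> e; exists false; rewrite -/m' e ?intrB in f1 f2 *; split; lra.
case=> e; exists false; rewrite -/m' e ?intrB in f1 f2 *; split; lra.
Qed.

Lemma coord_close b j t c : `|coord b j t - coord b j c| = 4 ^ j * `|t - c|.
Proof.
rewrite /coord (_ : _ - _ = 4 ^ j * (t - c)); last by ring.
by rewrite normrM (gtr0_norm (exp4_gt0 _)).
Qed.

Lemma grid_point_quarter b j t c : grid_point b j c ->
  `|coord b j t - coord b j c| < 1 ->
  (cell b j t)%:~R <= coord b j c <= (cell b j t)%:~R + 1.
Proof.
move=> [k ck] tc; rewrite ck; have := cell_itv b j t.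
rewrite ck ltr_distl in tc; move: tc => /andP[t1 t2] /andP[t3 t4].
have : (cell b j t)%:~R < (k + 1)%:~R :> R by rewrite intrD; lra.
have : (k - 1)%:~R < (cell b j t + 1)%:~R :> R by rewrite intrB intrD; lra.
rewrite !ltr_int -(intrD _ _ 1) !ler_int; lia.
Qed.

Lemma tent_grid_point b j t c : grid_point b j c ->
  `|coord b j t - coord b j c| < 1 -> tent b j (cell b j t) c = 0.
Proof.
move=> gc tc; have := grid_point_quarter gc tc; have [k ck] := gc.
rewrite /tent ck -[1]/(1%:~R) -intrD -!intrB !ler_int => ckt.
have [->|->] : k = cell b j t \/ k = cell b j t + 1 by lia.
  by rewrite subrr addrAC subrr add0r min_l ?mulr0// ler_int.
by rewrite subrr addrAC subrr add0r min_r ?mulr0// ler_int.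
Qed.

Lemma grid_pointS b j c : grid_point b j c -> grid_point b (j + 1) c.
Proof.
by move=> [k ck]; exists (4 * k + shift b); rewrite coordS ck intrD intrM.
Qed.

Lemma grid_point_between b j t t' : cell b j t != cell b j t' ->
  exists2 c, grid_point b j c & `|t - c| <= `|t - t'|.
Proof.
move=> tt'; have e0 : (4 : R) ^ j != 0 by rewrite gt_eqF// exp4_gt0.
pose pt k : R := (k%:~R + theta b) / 4 ^ j.
have ptE k : coord b j (pt k) = k%:~R by rewrite /coord/pt; field.
have /andP[t1 t2] := cell_itv b j t; have /andP[t1' t2'] := cell_itv b j t'.
have le c : `|coord b j t - coord b j c| <= `|coord b j t - coord b j t'| ->
    `|t - c| <= `|t - t'|.
  by rewrite !coord_close ler_pM2l// exp4_gt0.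
have : (cell b j t + 1 <= cell b j t' \/ cell b j t' + 1 <= cell b j t)%R by lia.
rewrite -!(ler_int R) !intrD => -[h|h].
  exists (pt (cell b j t')); first by eexists; exact: ptE.
  by apply: le; rewrite ptE !ler0_norm; lra.
exists (pt (cell b j t)); first by eexists; exact: ptE.
by apply: le; rewrite ptE !ger0_norm; lra.
Qed.

End grids.

(** * The random cascade *)

Section cascade.
Context {R : realType} {X : topologicalType} (u : X -> R).
Implicit Types (b : bool) (j a : int) (x y z : X).

Definition level_set b j x : set X := [set z | cell b j (u z) = cell b j (u x)].

(** A coin is named by a grid, a scale and a component. *)
Definition key_type : Type := option (bool * int * set X).
HB.instance Definition _ := Choice.on key_type.
Implicit Types (w : key_type -> bool) (k : key_type).

Definition key b j x : key_type :=
  Some (b, j, connected_component (level_set b j x) x).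

(** An additional coin that selects one of the two grids. *)
Definition selector : key_type := None.

Lemma key_level b j x b' j' x' : key b j x = key b' j' x' -> j = j'.
Proof. by case. Qed.

Lemma key_connected b j x y (S : set X) : connected S -> S x -> S y ->
  S `<=` level_set b j x -> key b j x = key b j y.
Proof.
move=> cS Sx Sy SL; rewrite /key; congr (Some (_, _, _)).
have -> : level_set b j y = level_set b j x.
  by rewrite /level_set (SL _ Sy).
apply: same_connected_component.
exact: (@connected_component_max _ _ S).
Qed.

Lemma key_component b j x y : key b j x = key b j y ->
  connected_component (level_set b j x) x y.
Proof. by case=> ->; exact: connected_component_refl. Qed.

Lemma key_cell b j x y : key b j x = key b j y ->
  cell b j (u x) = cell b j (u y).
Proof. by move=> /key_component/connected_component_sub. Qed.

Lemma level_set_sub b j x : level_set b (j + 1) x `<=` level_set b j x.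
Proof. by move=> z; exact: cell_sub. Qed.

Lemma key_sub b j x y : key b (j + 1) x = key b (j + 1) y -> key b j x = key b j y.
Proof.
move=> /key_component xy.
apply: (@key_connected _ _ _ _ (connected_component (level_set b (j + 1) x) x)) => //.
- exact: component_connected.
- exact: connected_component_refl.
- apply: subset_trans (@level_set_sub _ _ _); exact: connected_component_sub.
Qed.

Definition sign w k : R := if w k then 1 else -1.

Definition factor b j x w : R := 1 + sign w (key b j x) * slope b j (u x).

(** The slope of the cascade with respect to [u] near [x]. *)
Definition density b a n x w : R := \prod_(i < n) factor b (a + i%:Z) x w.

(** The noise of the [n] scales [a], ..., [a + n - 1] is added to [u]. *)
Definition cascade b a n x w : R := u x +
  \sum_(i < n) density b a i x w * sign w (key b (a + i%:Z) x) *
    tent b (a + i%:Z) (cell b (a + i%:Z) (u x)) (u x).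

Lemma abs_sign w k : `|sign w k| = 1.
Proof. by rewrite /sign; case: ifP; rewrite ?normrN normr1. Qed.

Lemma factor_bound b j x w : 2^-1 <= factor b j x w <= 3 / 2.
Proof.
rewrite /factor /sign; have := slope_bound b j (u x).
by case: ifP => _ /andP[]; lra.
Qed.

Lemma factor_gt0 b j x w : 0 < factor b j x w.
Proof. by have := factor_bound b j x w; lra. Qed.

Lemma densityS b a n x w :
  density b a n.+1 x w = density b a n x w * factor b (a + n%:Z) x w.
Proof. by rewrite /density big_ord_recr. Qed.

Lemma density0 b a x w : density b a 0 x w = 1.
Proof. by rewrite /density big_ord0. Qed.

Lemma density_gt0 b a n x w : 0 < density b a n x w.
Proof. by apply: prodr_gt0 => i _; exact: factor_gt0. Qed.

Lemma density_le b a n x w : density b a n x w <= (3 / 2) ^+ n.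
Proof.
elim: n => [|n ih]; first by rewrite density0.
have /andP[_ f2] := factor_bound b (a + n%:Z) x w.
by rewrite densityS exprSr ler_pM// ltW// ?factor_gt0// density_gt0.
Qed.

Lemma cascadeS b a n x w : cascade b a n.+1 x w = cascade b a n x w +
  density b a n x w * sign w (key b (a + n%:Z) x) *
    tent b (a + n%:Z) (cell b (a + n%:Z) (u x)) (u x).
Proof. by rewrite /cascade big_ord_recr/= addrA. Qed.

Lemma cascade0 b a x w : cascade b a 0 x w = u x.
Proof. by rewrite /cascade big_ord0 addr0. Qed.

(** The value at height [c] of the affine function of [u] that agrees with the
    cascade near [x]. *)
Definition intercept b a n x w (c : R) : R :=
  cascade b a n x w - density b a n x w * (u x - c).

Lemma interceptS b a n x w c :
  (cell b (a + n%:Z + 1) (u x))%:~R <= coord b (a + n%:Z + 1) c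
    <= (cell b (a + n%:Z + 1) (u x))%:~R + 1 ->
  intercept b a n.+1 x w c = intercept b a n x w c +
    density b a n x w * sign w (key b (a + n%:Z) x) *
      tent b (a + n%:Z) (cell b (a + n%:Z) (u x)) c.
Proof.
move=> /tent_affine/eqP; rewrite subr_eq => /eqP tc.
by rewrite /intercept cascadeS densityS /factor tc; ring.
Qed.

(** A connected set on which [u] varies by much less than the finest cell either
    lies over one cell, and then all its points have the same coins, or lies over
    two cells with a common end point [c]. Consider the first scale at which the
    second case occurs. Before it the points have the same coins, and from it on
    [c] is a division point of all scales, at which their tents vanish. Hence the
    affine functions attached to two points agree at [c]. *)
Lemma intercept_local b a n x y w (r : R) (S : set X) :
  connected S -> S x -> S y -> (forall z, S z -> `|u x - u z| <= r) ->
  (4 : R) ^ (a + n%:Z) * r <= 4^-1 ->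
  [/\ S `<=` level_set b (a + n%:Z) x, density b a n x w = density b a n y w &
      forall c : R, intercept b a n x w c = intercept b a n y w c] \/
  exists c : R, [/\ `|u x - c| <= r, grid_point b (a + n%:Z) c &
      intercept b a n x w c = intercept b a n y w c].
Proof.
move=> cS Sx Sy Sr.
have r0 : 0 <= r by apply: le_trans (Sr _ Sx).
have dist_y c : `|u x - c| <= r -> `|u y - c| <= 2 * r.
  move=> xc; rewrite (le_trans (ler_distD (u x) _ _))// distrC.
  by have := Sr _ Sy; lra.
have small_x (j : int) c : 4 ^ j * r <= 4^-1 -> `|u x - c| <= r ->
    `|coord b j (u x) - coord b j c| < 1.
  move=> jr xc; rewrite coord_close.
  have : 4 ^ j * `|u x - c| <= 4 ^ j * r by rewrite ler_pM2l ?exp4_gt0.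
  by lra.
have small_y (j : int) c : 4 ^ j * r <= 4^-1 -> `|u x - c| <= r ->
    `|coord b j (u y) - coord b j c| < 1.
  move=> jr /dist_y xc; rewrite coord_close.
  have : 4 ^ j * `|u y - c| <= 4 ^ j * (2 * r) by rewrite ler_pM2l ?exp4_gt0.
  by lra.
have split_cells (j : int) : ~ (S `<=` level_set b j x) -> exists c : R,
    `|u x - c| <= r /\ grid_point b j c.
  move=> /existsNP[z /not_implyP[Sz /eqP xz]]; rewrite eq_sym in xz.
  have [c ck xc] := grid_point_between xz.
  by exists c; split; [exact: le_trans xc (Sr _ Sz)|exact: ck].
elim: n => [|n ih].
  rewrite addr0 => ar.
  have [Sa|/split_cells[c [xc ck]]] := pselect (S `<=` level_set b a x).
    by left; split => // [|c]; rewrite /intercept ?cascade0 ?density0//; ring.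
  right; exists c; split => //.
  by rewrite /intercept !cascade0 !density0; ring.
rewrite (_ : a + n.+1%:Z = a + n%:Z + 1); last by lia.
move=> jr.
have jr' : (4 : R) ^ (a + n%:Z) * r <= 4^-1.
  apply: le_trans jr; rewrite [in leRHS]expfzDr// expr1z ler_wpM2r//.
  by rewrite ler_peMr// ?ltW ?exp4_gt0 ?ltr1n.
case: (ih jr') => [[Sj dxy ixy]|[c [xc ck cxy]]]; last first.
  right; exists c; split => //; first exact: grid_pointS.
  have ck' := grid_pointS ck.
  rewrite !interceptS ?(grid_point_quarter ck') ?small_x ?small_y//.
  by rewrite !(tent_grid_point ck) ?small_x ?small_y// cxy !mulr0.
have kxy := key_connected cS Sx Sy Sj.
have [Sj1|/split_cells[c [xc ck]]] :=
    pselect (S `<=` level_set b (a + n%:Z + 1) x); last first.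
  right; exists c; split => //.
  rewrite !interceptS ?(grid_point_quarter ck) ?small_x ?small_y//.
  by rewrite ixy dxy kxy (key_cell kxy).
have cxy : cell b (a + n%:Z + 1) (u x) = cell b (a + n%:Z + 1) (u y).
  by rewrite (Sj1 _ Sy).
have dxy' : density b a n.+1 x w = density b a n.+1 y w.
  by rewrite !densityS dxy /factor kxy (slope_sub cxy).
left; split => // c.
have : intercept b a n.+1 x w (u y) = intercept b a n.+1 y w (u y).
  have /andP[y1 /ltW y2] := cell_itv b (a + n%:Z + 1) (u y).
  by rewrite !interceptS ?cxy ?y1// ixy dxy kxy (key_cell kxy).
by rewrite /intercept dxy'; lra.
Qed.

Lemma cascade_local b a n x y w (r : R) (S : set X) :
  connected S -> S x -> S y -> (forall z, S z -> `|u x - u z| <= r) ->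
  (4 : R) ^ (a + n%:Z) * r <= 4^-1 ->
  `|cascade b a n x w - cascade b a n y w| <=
    (density b a n x w + density b a n y w) * (2 * r).
Proof.
move=> cS Sx Sy Sr jr.
have r0 : 0 <= r by apply: le_trans (Sr _ Sx).
have [c xc cxy] : exists2 c, `|u x - c| <= r &
    intercept b a n x w c = intercept b a n y w c.
  case: (intercept_local b w cS Sx Sy Sr jr) => [[_ _ ixy]|[c [xc _ ixy]]].
    by exists (u x) => //; rewrite subrr normr0.
  by exists c.
have yc : `|u y - c| <= 2 * r.
  rewrite (le_trans (ler_distD (u x) _ _))// distrC.
  by have := Sr _ Sy; lra.
have -> : cascade b a n x w - cascade b a n y w =
    density b a n x w * (u x - c) - density b a n y w * (u y - c).
  by move: cxy; rewrite /intercept; lra.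
rewrite (le_trans (ler_normB _ _))// !normrM !(gtr0_norm (density_gt0 _ _ _ _ _)).
by rewrite mulrDl lerD// ler_pM2l ?density_gt0//; lra.
Qed.

Lemma density_shift b a n x w :
  density b a n.+1 x w = factor b a x w * density b (a + 1) n x w.
Proof.
rewrite /density big_ord_recl addr0; congr (_ * _).
by apply: eq_bigr => i _; rewrite -addrA.
Qed.

(** Over half a cell the coarsest tent is affine, so that inside a component of
    scale [a + 1] the noise of scale [a] only stretches the cascade by a constant
    factor. *)
Lemma cascade_shift b a n x y w : key b (a + 1) x = key b (a + 1) y ->
  cascade b a n.+1 x w - cascade b a n.+1 y w =
  factor b a y w * (cascade b (a + 1) n x w - cascade b (a + 1) n y w).
Proof.
move=> xy; have kxy := key_sub xy; have cxy := key_cell xy.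
have fxy : factor b a x w = factor b a y w by rewrite /factor kxy (slope_sub cxy).
elim: n => [|n ih].
  rewrite !cascadeS !cascade0 !density0 addr0 kxy.
  have := @tent_affine _ b a (u x) (u y).
  have /andP[y1 /ltW y2] := cell_itv b (a + 1) (u y).
  rewrite cxy y1 y2 => /(_ isT) txy.
  rewrite /factor -(slope_sub cxy) (key_cell kxy) in txy *.
  rewrite !mul1r mulrDl -mulrA -txy; ring.
rewrite [in LHS]cascadeS [cascade b a n.+2 y w]cascadeS.
rewrite [in RHS]cascadeS [cascade b (a + 1) n.+1 y w]cascadeS.
have aE : a + n.+1%:Z = a + 1 + n%:Z by lia.
move: ih; rewrite !density_shift fxy aE => ih; move: (factor b a y w) ih => f ih.
set T1 := tent _ _ _ _; set T2 := tent _ _ _ _.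
have addrBB A1 B1 A2 B2 : A1 + B1 - (A2 + B2) = (A1 - A2) + (B1 - B2) :> R by ring.
rewrite addrBB.
by rewrite ih; ring.
Qed.

(** * Expectations *)

Section expectation.
Variable x0 : X.

(** The density at [x0] accumulated over the scales [-N], ..., [-1]. Dividing by
    it makes the cascades started at scale [-N] stabilize as [N] grows. *)
Definition base_density b N w : R := \prod_(n < N) factor b (- (n.+1)%:Z) x0 w.

(** The distribution of the coins of one grid and of the scales at least [-N] has
    the density [base_density] relative to fair coins, for every [N]: integrating
    a quotient by [base_density] amounts to integrating the numerator with fair
    coins. *)
Definition coin_bias k : R :=
  if k is Some (b, j, _) then
    if (j < 0) && (k == key b j x0) then (1 + slope b j (u x0)) / 2 else 2^-1
  else 2^-1.

Lemma coin_bias01 k : 0 <= coin_bias k <= 1.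
Proof.
rewrite /coin_bias; case: k => [[[b j] e]|]; last by lra.
by case: ifP => _; have := slope_bound b j (u x0); lra.
Qed.

Local Notation bmean := (mean coin_bias).

Lemma cylindrical_sign k : cylindrical (fun w => sign w k).
Proof.
apply: (cylindrical_comp (fun c : bool => if c then 1 else -1)).
exact: cylindrical_coord.
Qed.

Lemma cylindrical_factor b j x : cylindrical (factor b j x).
Proof.
apply: (cylindrical_comp (fun s => 1 + s * slope b j (u x))); exact: cylindrical_sign.
Qed.

Lemma cylindrical_prod n (g : nat -> (key_type -> bool) -> R) :
  (forall i, cylindrical (g i)) -> cylindrical (fun w => \prod_(i < n) g i w).
Proof.
move=> cg; elim: n => [|n ih].
  by under eq_fun do rewrite big_ord0; exact: cylindrical_cst.
by under eq_fun do rewrite big_ord_recr; exact: (cylindrical_comp2 *%R).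
Qed.

Lemma cylindrical_density b a n x : cylindrical (density b a n x).
Proof.
exact: (@cylindrical_prod n (fun i => factor b (a + i%:Z) x)
  (fun=> cylindrical_factor _ _ _)).
Qed.

Lemma cylindrical_base b N : cylindrical (base_density b N).
Proof.
exact: (@cylindrical_prod N (fun n => factor b (- (n.+1)%:Z) x0)
  (fun=> cylindrical_factor _ _ _)).
Qed.

Lemma cylindrical_cascade b a n x : cylindrical (cascade b a n x).
Proof.
elim: n => [|n ih].
  rewrite (_ : cascade _ _ _ _ = fun=> u x); first exact: cylindrical_cst.
  by apply/funext => w; rewrite cascade0.
rewrite (_ : cascade _ _ _ _ = fun w => cascade b a n x w +
  density b a n x w * sign w (key b (a + n%:Z) x) *
    tent b (a + n%:Z) (cell b (a + n%:Z) (u x)) (u x)); last first.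
  by apply/funext => w; rewrite cascadeS.
apply: (cylindrical_comp2 +%R) => //; apply: (cylindrical_comp ( *%R^~ _)).
apply: (cylindrical_comp2 *%R); [exact: cylindrical_density|exact: cylindrical_sign].
Qed.

Lemma base_density_gt0 b N w : 0 < base_density b N w.
Proof. by apply: prodr_gt0 => i _; exact: factor_gt0. Qed.

Lemma base_densityS b N w :
  base_density b N.+1 w = base_density b N w * factor b (- (N.+1)%:Z) x0 w.
Proof. by rewrite /base_density big_ord_recr. Qed.

Lemma sign_upd w k c l : sign (upd w k c) l =
  if l == k then (if c then 1 else -1) else sign w l.
Proof. by rewrite /sign /upd; case: eqP. Qed.

Lemma factor_upd b j x w k c : k != key b j x ->
  factor b j x (upd w k c) = factor b j x w.
Proof. by move=> kx; rewrite /factor sign_upd eq_sym (negbTE kx). Qed.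

Lemma density_upd b a n x w k c :
  (forall i, (i < n)%N -> k != key b (a + i%:Z) x) ->
  density b a n x (upd w k c) = density b a n x w.
Proof. by move=> kx; apply: eq_bigr => i _; rewrite factor_upd// kx. Qed.

Lemma density_upd_level b a n x w j y c : a + n%:Z <= j ->
  density b a n x (upd w (key b j y) c) = density b a n x w.
Proof.
move=> nj; apply: density_upd => i i_n; apply/eqP => /key_level.
by lia.
Qed.

Lemma coin_bias_fair b j x : ~~ ((j < 0) && (key b j x == key b j x0)) ->
  coin_bias (key b j x) = 2^-1.
Proof. by rewrite /coin_bias /= => /negbTE ->. Qed.

Lemma coin_bias_base b n :
  coin_bias (key b (- n.+1%:Z) x0) = (1 + slope b (- n.+1%:Z) (u x0)) / 2.
Proof. by rewrite /coin_bias/= eqxx. Qed.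

(** With the weight [1 / base_density] every coin of scale at least [-N] is fair:
    for a coin of the branch of [x0] the bias cancels against its factor in
    [base_density]. Coins of larger scales keep their bias, which is why the
    cascade starts at scale [-N]. *)
Lemma mean_sign0 b N j x (g : (key_type -> bool) -> R) : - N%:Z <= j ->
  cylindrical g -> (forall w c, g (upd w (key b j x) c) = g w) ->
  bmean (fun w => g w * sign w (key b j x) / base_density b N w) = 0.
Proof.
move=> Nj cg gk; rewrite -(mean_avg _ (key b j x)); last first.
  apply: (cylindrical_comp2 (fun s t => s / t)); last exact: cylindrical_base.
  by apply: (cylindrical_comp2 *%R) => //; exact: cylindrical_sign.
rewrite -[RHS](@mean_cst _ _ coin_bias 0); congr (mean coin_bias _); apply/funext => w.
rewrite /avg !gk !sign_upd eqxx.
have [/andP[j0 /eqP kx]|fair] := boolP ((j < 0) && (key b j x == key b j x0)).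
  have [n jn nN] : exists2 n : nat, j = - n.+1%:Z & (n < N)%N.
    by exists (`|j|%N.-1); lia.
  pose B w' := \prod_(i < N | i != Ordinal nN) factor b (- i.+1%:Z) x0 w'.
  have split_base w' : base_density b N w' = factor b j x0 w' * B w'.
    by rewrite /base_density (bigD1 (Ordinal nN)) //= jn.
  have BE c : B (upd w (key b j x0) c) = B w.
    apply: eq_bigr => i inN; rewrite factor_upd//; apply/eqP => /key_level ni.
    by move/eqP: inN; apply; apply/val_inj => /=; lia.
  have bias : coin_bias (key b j x0) = (1 + slope b j (u x0)) / 2.
    by rewrite jn coin_bias_base.
  rewrite kx bias !split_base !BE /factor !sign_upd eqxx.
  have B0 : B w != 0 by rewrite gt_eqF// prodr_gt0// => i _; exact: factor_gt0.
  have /andP[s1 s2] := slope_bound b j (u x0).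
  move: (B w) (slope b j (u x0)) (g w) B0 s1 s2 => C s h C0 s1 s2.
  by field; rewrite C0/=; apply/andP; split; rewrite gt_eqF//; lra.
rewrite coin_bias_fair//.
have BE c : base_density b N (upd w (key b j x) c) = base_density b N w.
  apply: eq_bigr => i _; rewrite factor_upd//; apply/eqP => kx.
  move/negP: fair; apply; have jE := key_level kx.
  by rewrite [X in _ && (_ == key _ X _)]jE kx eqxx andbT jE; lia.
by rewrite !BE; field; rewrite gt_eqF// base_density_gt0.
Qed.

Lemma mean_base b N : bmean (fun w => (base_density b N w)^-1) = 1.
Proof.
elim: N => [|N ih].
  rewrite -[RHS](@mean_cst _ _ coin_bias 1); congr (mean coin_bias _).
  by apply/funext => w; rewrite /base_density big_ord0 invr1.
rewrite -{}ih -(mean_avg _ (key b (- N.+1%:Z) x0)); last first.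
  by apply: cylindrical_comp; exact: cylindrical_base.
congr (mean coin_bias _); apply/funext => w; rewrite /avg !base_densityS coin_bias_base.
have BE c : base_density b N (upd w (key b (- N.+1%:Z) x0) c) = base_density b N w.
  apply: eq_bigr => i _; rewrite factor_upd//; apply/eqP => /key_level.
  by have := ltn_ord i; lia.
rewrite !BE /factor !sign_upd eqxx.
have := base_density_gt0 b N w; have /andP[s1 s2] := slope_bound b (- N.+1%:Z) (u x0).
move: (base_density b N w) => B B0.
set s := slope _ _ _ in s1 s2 *; clearbody s; clear -B0 s1 s2.
by field; rewrite !gt_eqF//; lra.
Qed.

(** The factor added at each scale is [1] plus a multiple of a coin that the
    earlier factors do not involve. *)
Lemma mean_density b N n x :
  bmean (fun w => density b (- N%:Z) n x w / base_density b N w) = 1.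
Proof.
elim: n => [|n ih].
  rewrite -[RHS](mean_base b N); congr (mean coin_bias _); apply/funext => w.
  by rewrite density0 mul1r.
rewrite -[RHS]addr0 -{1}ih.
have cs : cylindrical (fun w =>
    density b (- N%:Z) n x w * slope b (- N%:Z + n%:Z) (u x)).
  by apply: (cylindrical_comp ( *%R^~ _)); exact: cylindrical_density.
rewrite -(@mean_sign0 b N (- N%:Z + n%:Z) x _ _ cs).
- rewrite -meanD.
  + congr (mean coin_bias _); apply/funext => w; rewrite densityS /factor; ring.
  + apply: (cylindrical_comp2 (fun s t => s / t)); last exact: cylindrical_base.
    exact: cylindrical_density.
  + apply: (cylindrical_comp2 (fun s t => s / t)); last exact: cylindrical_base.
    by apply: (cylindrical_comp2 *%R) => //; exact: cylindrical_sign.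
- by lia.
- by move=> w c; rewrite density_upd_level.
Qed.

(** Only the noise that carries the tested coin itself is correlated with it: in
    a product of two different coins and the density before the noise, a coin of
    the finest scale occurs in no other factor and averages to zero. *)
Lemma mean_cascade_sign b N n j x z : - N%:Z <= j ->
  bmean (fun w => cascade b (- N%:Z) n z w * sign w (key b j x) / base_density b N w)
  = if (j < - N%:Z + n%:Z) && (key b j z == key b j x)
    then tent b j (cell b j (u z)) (u z) else 0.
Proof.
move=> Nj.
have cB (g : (key_type -> bool) -> R) : cylindrical g ->
    cylindrical (fun w => g w / base_density b N w).
  move=> cg; apply: (cylindrical_comp2 (fun s t => s / t)) => //.
  exact: cylindrical_base.
have cS (g : (key_type -> bool) -> R) k : cylindrical g ->
    cylindrical (fun w => g w * sign w k).
  by move=> cg; apply: (cylindrical_comp2 *%R) => //; exact: cylindrical_sign.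
elim: n => [|n ih].
  rewrite addr0 (ltNge j) Nj/=.
  rewrite -[RHS](@mean_sign0 b N j x (fun=> u z) Nj (cylindrical_cst _))//.
  by congr (mean coin_bias _); apply/funext => w; rewrite cascade0.
set l := - N%:Z + n%:Z in ih *.
have lS : - N%:Z + n.+1%:Z = l + 1 by lia.
pose T := tent b l (cell b l (u z)) (u z).
pose D := density b (- N%:Z) n z.
have cD : cylindrical D by exact: cylindrical_density.
transitivity
    (bmean (fun w => cascade b (- N%:Z) n z w * sign w (key b j x) /
                     base_density b N w) +
     T * bmean (fun w => D w * sign w (key b l z) * sign w (key b j x) /
                         base_density b N w)).
  rewrite -meanZ; last by exact/cB/cS/cS.
  rewrite -meanD.
  - congr (mean coin_bias _); apply/funext => w.
    by rewrite cascadeS -/l -/T -/(D w); ring.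
  - by apply: cB; apply: cS; exact: cylindrical_cascade.
  - by apply: (cylindrical_comp ( *%R _)); exact/cB/cS/cS.
rewrite {}ih lS.
have [zx|zx] := eqVneq (key b l z) (key b j x).
  rewrite (_ : bmean _ = 1); last first.
    rewrite -[RHS](mean_density b N n z); congr (mean coin_bias _); apply/funext => w.
    rewrite zx -(mulrA (D w)) (_ : sign w _ * sign w _ = 1) ?mulr1//.
    by rewrite /sign; case: ifP => _; rewrite ?mulrNN mulr1.
  have lj := key_level zx; rewrite -lj ltxx /= add0r mulr1 ltrDl ltr01 /=.
  by rewrite -lj in zx; rewrite zx eqxx.
rewrite (_ : bmean _ = 0) ?mulr0 ?addr0.
  congr (if _ then _ else _).
  have [jl|jl] := eqVneq j l; last by rewrite ltzD1 le_eqVlt (negbTE jl).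
  by move: zx; rewrite -jl => /negbTE ->; rewrite !andbF.
have [jl|lj] := ltP j l.
  rewrite -[RHS](@mean_sign0 b N l z (fun w => D w * sign w (key b j x))).
  - by congr (mean coin_bias _); apply/funext => w; ring.
  - by rewrite /l; lia.
  - exact: cS.
  - by move=> w c; rewrite /D density_upd_level// sign_upd eq_sym (negbTE zx).
rewrite -[RHS](@mean_sign0 b N j x (fun w => D w * sign w (key b l z)))//.
- exact: cS.
- by move=> w c; rewrite /D density_upd_level// sign_upd (negbTE zx).
Qed.

End expectation.
End cascade.

(** * Paths in length spaces *)

Section length_spaces.
Context {R : realType} {X : metricType R}.
Hypothesis hX : length_space X.
Implicit Types (x y z : X) (e : R).

Lemma short_path x y e : 0 < e -> exists2 g, is_path x y g &
  forall s, itv_partition 0 1 s -> polygonal_length g s <= mdist x y + e.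
Proof.
move=> e0; have : ((mdist x y)%:E < (mdist x y + e)%:E)%E by rewrite lte_fin ltrDl.
rewrite [X in (X < _)%E](hX x y) => /ereal_inf_lt[_ [g xyg <-] ge].
exists g => // s s01; rewrite -lee_fin; apply: le_trans (ltW ge).
by apply: ereal_sup_ubound; exists s.
Qed.

Lemma short_connected x y e : 0 < e -> exists S : set X,
  [/\ connected S, S x, S y & forall z, S z -> mdist x z <= mdist x y + e].
Proof.
move=> e0; have [g [cg g0 g1] ge] := short_path x y e0.
exists (g @` `[0, 1]); split.
- apply: connected_continuous_connected cg; exact: segment_connected.
- by exists 0; rewrite //= in_itv /= lexx ler01.
- by exists 1; rewrite //= in_itv /= lexx ler01.
move=> _ [t /=] + <-; rewrite in_itv/= => /andP[t0 t1].
have [->|tN0] := eqVneq t 0; first by rewrite g0 mdistxx addr_ge0 ?mdist_ge0// ltW.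
have [->|tN1] := eqVneq t 1; first by rewrite g1 lerDl ltW.
have /ge : itv_partition 0 1 [:: t; 1].
  by split => //=; rewrite !lt_neqAle eq_sym tN0 t0 tN1 t1.
rewrite /polygonal_length/= !big_nat_recl//= big_geq//= g0 g1 addr0.
by apply: le_trans; rewrite lerDl mdist_ge0.
Qed.

Lemma path_unif_continuous (g : R -> X) e : {within `[0, 1], continuous g} ->
  0 < e -> \forall n \near \oo, forall s t, 0 <= s <= 1 -> 0 <= t <= 1 ->
    `|s - t| <= n.+1%:R^-1 -> mdist (g s) (g t) < e.
Proof.
move=> cg e0.
have e20 : 0 < e / 2 by rewrite divr_gt0.
have := (compact_near_coveringP _).1 (@segment_compact R 0 1) nat \oo
  (fun n t => 0 <= t <= 1 -> forall s, 0 <= s <= 1 ->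
    `|s - t| <= n.+1%:R^-1 -> mdist (g s) (g t) < e).
case=> [t /= t01|n _ nP]; last first.
  exists n => // m /= nm s t s01 t01 st.
  by apply: (nP m nm t) => //=; rewrite in_itv.
have : \forall s \near t, 0 <= s <= 1 -> mdist (g t) (g s) < e / 2.
  have := cg t (ball (g t) (e / 2)) (nbhsx_ballx (g t) _ e20).
  rewrite /= nbhs_simpl/= /nbhs/=. rewrite -nbhs_subspace_in//.
  rewrite ballEmdist /within/=; apply: filterS => s gs s01.
  by apply: gs; rewrite in_itv.
move=> /nbhs_ballP[r /= r0 tr].
exists (ball t (r / 2), [set n | n.+1%:R^-1 < r / 2]).
  split; first by apply: nbhsx_ballx; rewrite divr_gt0.
  by apply: near_infty_natSinv_lt (PosNum _) => //; rewrite divr_gt0.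
move=> [t' n] /= [tt' nr] t'01 s s01 st'.
rewrite (splitr e) (le_lt_trans (metric_triangle _ (g t) _))// ltrD//.
  rewrite metric_sym; apply: tr => //=.
  rewrite /ball/= in tt' *.
  rewrite (splitr r) -(subrK t' t) -addrA.
  rewrite (le_lt_trans (ler_normD _ _))// ltrD//.
  by rewrite distrC (le_lt_trans st').
apply: tr => //; apply: le_ball tt'.
by rewrite ler_pdivrMr// ler_peMr ?ler1n// ltW.
Qed.

(** A pseudometric that is locally Lipschitz is globally Lipschitz: compare them
    along a fine subdivision of a nearly shortest path. *)
Lemma locally_lipschitz (Phi : X -> X -> R) (K delta : R) :
  0 <= K -> 0 < delta -> (forall x, Phi x x = 0) ->
  (forall y x z, Phi x z <= Phi x y + Phi y z) ->
  (forall x y, mdist x y < delta -> Phi x y <= K * mdist x y) ->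
  forall x y, Phi x y <= K * mdist x y.
Proof.
move=> K0 d0 Phi0 tri loc x y.
suff le_e e : 0 < e -> Phi x y <= K * (mdist x y + e).
  apply/ler_addgt0Pr => e e0.
  have K1 : 0 < K + 1 by rewrite ltr_wpDl.
  have := le_e (e / (K + 1)) (divr_gt0 e0 K1).
  rewrite mulrDr => /le_trans; apply; rewrite lerD2l mulrA ler_pdivrMr//.
  by rewrite mulrDr mulr1 mulrC lerDl ltW.
move=> e0; have [g [cg g0 g1] ge] := short_path x y e0.
have [n _ /(_ n (leqnn n)) gn] := path_unif_continuous cg d0.
pose N := n.+1; pose t i : R := i%:R / N%:R.
have N0 : (0 : R) < N%:R by rewrite ltr0n.
have t01 i : (i <= N)%N -> 0 <= t i <= 1.
  by move=> iN; rewrite divr_ge0//= ler_pdivrMr// mul1r ler_nat.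
have tS i : t i.+1 - t i = N%:R^-1 by rewrite /t -mulrBl -natrB// subSnn mul1r.
have nth_t i : (i <= N)%N -> nth 1 (0 :: mkseq (fun i => t i.+1) N) i = t i.
  case: i => [_|i iN] /=; first by rewrite /t mul0r.
  by rewrite nth_mkseq.
have PhiN m : Phi (g (t 0%N)) (g (t m)) <= \sum_(0 <= i < m) Phi (g (t i)) (g (t i.+1)).
  elim: m => [|m ih]; first by rewrite big_geq// Phi0.
  by rewrite big_nat_recr//= (le_trans (tri (g (t m)) _ _))// lerD2r.
have := PhiN N.
rewrite {1}/t mul0r g0 {1}/t divff ?lt0r_neq0// g1 => /le_trans; apply.
apply: le_trans (_ : K * polygonal_length g (mkseq (fun i => t i.+1) N) <= _).
  rewrite /polygonal_length size_mkseq mulr_sumr !big_nat.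
  apply: ler_sum => i /andP[_ iN].
  rewrite /= nth_mkseq// nth_t; last exact: ltnW.
  apply: loc; apply: gn; [exact/t01/ltnW|exact: t01|].
  by rewrite distrC tS ger0_norm ?invr_ge0.
rewrite ler_wpM2l//; apply: ge; split; last first.
  by rewrite (last_nth 1) size_mkseq nth_t// /t divff ?lt0r_neq0.
apply/(pathP 1) => i; rewrite size_mkseq => iN.
rewrite nth_mkseq// nth_t; last exact: ltnW.
by rewrite -subr_gt0 tS invr_gt0.
Qed.

End length_spaces.

(** * Functions as elements of L1 *)

Section L1_representatives.
Context d (T : measurableType d) (R : realType).
Variable mu : {measure set T -> \bar R}.
Implicit Types f g : T -> R.

Lemma L1_class f : mu.-integrable setT (EFin \o f) ->
  exists F : LspaceType1 mu, (F : T -> R) = f %[ae mu].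
Proof.
move=> /integrableP[/measurable_EFinP mf intf].
have fm : (f : T -> measurableTypeR R) \in mfun by exact: mem_set.
pose h : {mfun T >-> measurableTypeR R} := mfun_Sub fm.
pose q : {mfun_ mu, T >-> measurableTypeR R} := (\pi h)%qT.
have qh : (q : T -> R) = f %[ae mu].
  have : (repr q == h %[mod {mfun_ mu, T >-> measurableTypeR R}])%qT.
    by rewrite reprK.
  by rewrite eqmodE => /asboolP.
have mq : measurable_fun setT (q : T -> R) by exact: (measurable_funPT (repr q)).
have fq : finite_norm mu 1 (q : T -> R).
  rewrite /finite_norm Lnorm1 (le_lt_trans _ intf)//.
  rewrite (@ae_eq_integral _ _ _ mu setT (fun x => `|(EFin \o f) x|%E))//.
  - by apply/measurableT_comp => //; exact/measurable_EFinP.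
  - by apply/measurableT_comp => //; exact/measurable_EFinP.
  - by apply: filterS qh => x /= qfx /qfx ->.
pose F : LspaceType1 mu := HB.pack q (isFinLebesgue.Build _ _ _ _ _ (lexx 1%E) q fq).
by exists F.
Qed.

Lemma mdist_L1 f g (F G : LspaceType1 mu) :
  measurable_fun setT f -> measurable_fun setT g ->
  (F : T -> R) = f %[ae mu] -> (G : T -> R) = g %[ae mu] ->
  mdist F G = fine (\int[mu]_x `|f x - g x|%:E)%E.
Proof.
move=> mf mg Ff Gg; rewrite mdist_L1E /L1_dist Lnorm1; congr fine.
have mF (H : LspaceType1 mu) : measurable_fun setT (H : T -> R).
  exact: (measurable_funPT (repr (LebesgueSpace.sort H))).
apply: ae_eq_integral => //.
- by apply/measurable_EFinP/measurableT_comp => //; exact: measurable_funB.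
- by apply/measurable_EFinP/measurableT_comp => //; exact: measurable_funB.
- by apply: filterS2 Ff Gg => x /= Fx Gx xT; rewrite (Fx xT) (Gx xT).
Qed.

End L1_representatives.

(** * Limits of renormalized cascades *)

(** Adding and subtracting a geometric bound for the remaining steps turns [v]
    into two monotone sequences that enclose it. *)
Lemma cvg_geometric_steps {R : realType} (v : R^nat) (K : R) :
  (forall n, `|v n.+1 - v n| <= K / 2 ^+ n) ->
  cvgn v /\ forall n, `|limn v - v n| <= 2 * K / 2 ^+ n.
Proof.
move=> vK; pose e n : R := 2 * K / 2 ^+ n.
have eS n : e n - e n.+1 = K / 2 ^+ n.
  by rewrite /e exprS; field; rewrite expf_neq0.
have e0 : e @ \oo --> 0.
  rewrite (_ : e = geometric (2 * K) 2^-1).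
    by apply: cvg_geometric; rewrite ger0_norm ?invr_ge0// invf_lt1// ltr1n.
  by apply/funext => n; rewrite /e /geometric/= exprVn.
have K0 : 0 <= K by have := le_trans (normr_ge0 _) (vK 0%N); rewrite expr0 divr1.
have en0 n : 0 <= e n by rewrite /e divr_ge0 ?exprn_ge0// mulr_ge0.
have dec : nonincreasing_seq (v \+ e).
  apply/nonincreasing_seqP => n /=.
  have := ler_norm (v n.+1 - v n); move=> /le_trans/(_ (vK n)).
  by rewrite -eS; lra.
have inc : nondecreasing_seq (v \- e).
  apply/nondecreasing_seqP => n /=.
  have := ler_norm (v n - v n.+1); rewrite distrC => /le_trans/(_ (vK n)).
  by rewrite -eS; lra.
have cd : cvgn (v \+ e).
  apply: nonincreasing_is_cvgn => //; exists (v 0%N - e 0%N) => _ [n _ <-] /=.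
  by apply: le_trans (inc _ _ (leq0n n)) _ => /=; have := en0 n; lra.
have cv : v @ \oo --> limn (v \+ e).
  rewrite -[X in _ --> X]subr0 (_ : v = (v \+ e) \- e); last first.
    by apply/funext => n /=; rewrite addrK.
  apply: cvgB => //; rewrite (_ : _ \- _ \+ _ = v \+ e)//.
  by apply/funext => n /=; rewrite addrK.
split; first by apply/cvg_ex; eexists; exact: cv.
have ci : (v \- e) @ \oo --> limn (v \+ e).
  by rewrite -[X in _ --> X]subr0; apply: cvgB.
rewrite (cvg_lim _ cv)// => n; rewrite ler_distl.
have := nonincreasing_cvgn_ge dec cd n.
have := nondecreasing_cvgn_le inc (cvgP _ ci) n; rewrite (cvg_lim _ ci)//=.
by move=> -> ->.
Qed.

Section stages.
Context {R : realType} {X : topologicalType} (u : X -> R) (x0 : X).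
Implicit Types (b : bool) (x y : X) (N n : nat) (w : key_type (X := X) -> bool).

Local Notation bmean := (mean (coin_bias u x0)).

(** The renormalized cascade with the scales [-N], ..., [n - N - 1]. *)
Definition stage b N n x w : R :=
  (cascade u b (- N%:Z) n x w - cascade u b (- N%:Z) n x0 w) /
    base_density u x0 b N w.

Definition limit_stage b N x w : R := limn (fun n => stage b N n x w).

Lemma cylindrical_stage b N n x : cylindrical (stage b N n x).
Proof.
apply: (cylindrical_comp2 (fun s t => s / t)); last exact: cylindrical_base.
by apply: (cylindrical_comp2 (fun s t => s - t)); exact: cylindrical_cascade.
Qed.

Lemma base_density_ge b N w : 2^-1 ^+ N <= base_density u x0 b N w.
Proof.
elim: N => [|N ih]; first by rewrite /base_density big_ord0.
rewrite base_densityS exprSr ler_pM ?exprn_ge0//.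
by have /andP[] := factor_bound u b (- N.+1%:Z) x0 w.
Qed.

Lemma base_density_inv_le b N w : (base_density u x0 b N w)^-1 <= 2 ^+ N.
Proof.
by rewrite invf_ple ?posrE ?base_density_gt0 ?exprn_gt0// -exprVn base_density_ge.
Qed.

Lemma exp4_level N n : (4 : R) ^ (- N%:Z + n%:Z) = 4 ^+ n / 4 ^+ N.
Proof. by rewrite expfzDr// -exprnN mulrC. Qed.

Lemma cascade_step b N n x w :
  `|cascade u b (- N%:Z) n.+1 x w - cascade u b (- N%:Z) n x w| <=
    4 ^+ N / 2 / 2 ^+ n.
Proof.
rewrite cascadeS addrAC subrr add0r 2!normrM abs_sign mulr1.
rewrite (gtr0_norm (density_gt0 _ _ _ _ _ _)) (ger0_norm (tent_ge0 _ _ _)).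
have -> : (4 : R) ^+ N / 2 / 2 ^+ n = 2 ^+ n * (2 * 4 ^ (- N%:Z + n%:Z))^-1.
  rewrite exp4_level (_ : 4 ^+ n = 2 ^+ n * 2 ^+ n).
    by field; rewrite !expf_neq0.
  by rewrite -exprMn -natrM.
rewrite ler_pM ?tent_ge0 ?tent_le ?(ltW (density_gt0 _ _ _ _ _ _))//.
apply: le_trans (density_le _ _ _ _ _ _) _.
by rewrite lerXn2r ?nnegrE//; lra.
Qed.

(** The tent contributes [4^-n], the density at most [2^n]; the factor [8^N]
    accounts for the starting scale and for [base_density]. *)
Lemma stage_step b N n x w :
  `|stage b N n.+1 x w - stage b N n x w| <= 8 ^+ N / 2 ^+ n.
Proof.
rewrite /stage -mulrBl normrM.
have -> : (8 : R) ^+ N / 2 ^+ n = (4 ^+ N / 2 / 2 ^+ n + 4 ^+ N / 2 / 2 ^+ n) * 2 ^+ N.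
  rewrite (_ : 8 ^+ N = 4 ^+ N * 2 ^+ N).
    by field; rewrite !expf_neq0.
  by rewrite -exprMn -natrM.
rewrite ler_pM//; last first.
  by rewrite gtr0_norm ?base_density_inv_le// invr_gt0 base_density_gt0.
set A := cascade _ _ _ _ x w; set B := cascade _ _ _ _ x0 w.
set A' := cascade _ _ _ _ x w; set B' := cascade _ _ _ _ x0 w.
rewrite (_ : A - B - (A' - B') = (A - A') - (B - B')); last by ring.
by rewrite (le_trans (ler_normB _ _))// lerD// cascade_step.
Qed.

Lemma cvg_stage b N x w : cvgn (fun n => stage b N n x w).
Proof.
by have [] := @cvg_geometric_steps _ (fun n => stage b N n x w) _
  (fun n => stage_step b N n x w).
Qed.

Lemma limit_stage_close b N n x w :
  `|limit_stage b N x w - stage b N n x w| <= 2 * 8 ^+ N / 2 ^+ n.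
Proof.
by have [_] := @cvg_geometric_steps _ (fun n => stage b N n x w) _
  (fun n => stage_step b N n x w).
Qed.

Definition absorbed x N := forall b, key u b (- N%:Z) x = key u b (- N%:Z) x0.

Lemma absorbedS x N : absorbed x N -> absorbed x N.+1.
Proof. by move=> xN b; apply: key_sub; rewrite (_ : _ + 1 = - N%:Z) ?xN//; lia. Qed.

Lemma absorbed_le x N N' : (N <= N')%N -> absorbed x N -> absorbed x N'.
Proof. by move=> /subnK <- xN; elim: (N' - N)%N => //= k; exact: absorbedS. Qed.

(** Starting one scale earlier stretches differences by the factor of the base
    point at that scale, which is the factor that [base_density] gains. *)
Lemma stage_shift b N n x w : absorbed x N -> stage b N.+1 n.+1 x w = stage b N n x w.
Proof.
move=> xN; rewrite /stage.
have aE : - N.+1%:Z + 1 = - N%:Z by lia.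
rewrite cascade_shift aE ?xN// base_densityS.
by field; rewrite !gt_eqF ?base_density_gt0 ?factor_gt0.
Qed.

Lemma limit_stageS b N x w : absorbed x N ->
  limit_stage b N.+1 x w = limit_stage b N x w.
Proof.
move=> xN; apply: cvg_lim => //; rewrite -cvg_shiftS.
under eq_fun do rewrite stage_shift//.
exact: cvg_stage.
Qed.

Lemma limit_stage_stable b N N' x w : (N <= N')%N -> absorbed x N ->
  limit_stage b N' x w = limit_stage b N x w.
Proof.
move=> /subnK <- xN; elim: (N' - N)%N => //= k <-.
by rewrite limit_stageS//; apply: absorbed_le xN; rewrite leq_addl.
Qed.

Definition depth x : nat := xget 0%N [set N | absorbed x N].

(** The starting scale depends on the point. Any coarser starting scale gives the
    same value, so that two points can be compared through a common one. *)
Definition embed x w : R := limit_stage (w selector) (depth x) x w.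

Hypothesis absorbing : forall x, exists N, absorbed x N.

Lemma depthP x : absorbed x (depth x).
Proof. by rewrite /depth; case: xgetP => // none; have [N /none] := absorbing x. Qed.

Lemma embed_close x N n w : (depth x <= N)%N ->
  `|embed x w - stage (w selector) N n x w| <= 2 * 8 ^+ N / 2 ^+ n.
Proof.
move=> xN; rewrite /embed -(limit_stage_stable _ _ xN); last exact: depthP.
exact: limit_stage_close.
Qed.

Lemma cylindrical_selected N n x : cylindrical (fun w => stage (w selector) N n x w).
Proof.
rewrite (_ : (fun _ => _) =
    fun w => if w selector then stage true N n x w else stage false N n x w).
  apply: (cylindrical_comp2 (fun (g : R * bool) t => if g.2 then g.1 else t)
    (g1 := fun w => (stage true N n x w, w selector))).
    apply: (cylindrical_comp2 pair); first exact: cylindrical_stage.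
    exact: cylindrical_coord.
  exact: cylindrical_stage.
by apply/funext => w; case: (w selector).
Qed.

Local Notation P := (coin_measure (coin_bias01 u x0)).

Lemma measurable_embed x :
  measurable_fun setT (embed x : coin_space (K := key_type (X := X)) -> R).
Proof.
have mS n := cylindrical_measurable_fun (cylindrical_selected (depth x) n x).
apply: (measurable_fun_cvg mS) => w _; exact: cvg_stage.
Qed.

Lemma integrable_embed x : P.-integrable setT (EFin \o embed x).
Proof.
apply: measurable_bounded_integrable => //.
- by rewrite [ltLHS]coin_measure_setT ltry.
- exact: measurable_embed.
pose M : R := 2 * 8 ^+ depth x + `|u x - u x0| * 2 ^+ depth x.
exists M; split; first exact: num_real.
move=> M' MM' w _ /=; apply: le_trans (ltW MM').
have := embed_close 0 w (leqnn (depth x)); rewrite expr0 divr1 => h.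
rewrite -[embed x w](subrK (stage (w selector) (depth x) 0 x w)).
rewrite (le_trans (ler_normD _ _))// lerD//.
rewrite /stage !cascade0 normrM ler_wpM2l//.
by rewrite gtr0_norm ?base_density_inv_le// invr_gt0 base_density_gt0.
Qed.

Lemma integral_embed_close x y N n : (depth x <= N)%N -> (depth y <= N)%N ->
  let M := bmean (fun w =>
    `|stage (w selector) N n x w - stage (w selector) N n y w|) in
  let e := 4 * 8 ^+ N / 2 ^+ n in
  ((M - e)%:E <= \int[P]_w `|embed x w - embed y w|%:E <= (M + e)%:E)%E.
Proof.
move=> xN yN /=.
set M := bmean _; set e := 4 * _ / _.
have e0 : 0 <= e by rewrite /e divr_ge0 ?exprn_ge0// mulr_ge0 ?exprn_ge0.
pose D w := `|stage (w selector) N n x w - stage (w selector) N n y w|.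
have cD : cylindrical D.
  by apply: (cylindrical_comp2 (fun s t => `|s - t|)); exact: cylindrical_selected.
have close w : `|(embed x w - embed y w) -
    (stage (w selector) N n x w - stage (w selector) N n y w)| <= e.
  have hx := embed_close n w xN; have hy := embed_close n w yN.
  set A := embed x w in hx *; set B := embed y w in hy *.
  set A' := stage _ _ _ x w in hx *; set B' := stage _ _ _ y w in hy *.
  rewrite (_ : A - B - (A' - B') = (A - A') - (B - B')); last by ring.
  have -> : e = 2 * 8 ^+ N / 2 ^+ n + 2 * 8 ^+ N / 2 ^+ n.
    by rewrite /e; field; rewrite expf_neq0.
  by rewrite (le_trans (ler_normB _ _))// lerD.
have mE : measurable_fun setT (fun w : coin_space => `|embed x w - embed y w|%:E).
  apply/measurable_EFinP/measurableT_comp => //.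
  by apply: measurable_funB; exact: measurable_embed.
apply/andP; split; last first.
  have cDe : cylindrical (fun w => D w + e) by apply: (cylindrical_comp (+%R^~ e)).
  have -> : M + e = bmean (fun w => D w + e).
    by rewrite meanD ?mean_cst//; exact: cylindrical_cst.
  rewrite -(integral_cylindrical (coin_bias01 u x0))//; last first.
    by move=> w; rewrite addr_ge0 /D.
  apply: ge0_le_integral => //.
  - by apply/measurable_EFinP; exact: (cylindrical_measurable_fun cDe).
  - move=> w _; rewrite lee_fin -lerBlDl (le_trans _ (close w))//.
    exact: lerB_dist.
rewrite EFinB leeBlDr// -(integral_cylindrical (coin_bias01 u x0) cD)//; last first.
  by move=> w; rewrite /D.
have <- : (\int[P]_w e%:E = e%:E)%E.
  by rewrite integral_cst// [X in (_ * X)%E]coin_measure_setT mule1.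
rewrite -ge0_integralD//.
- apply: ge0_le_integral => //.
  + by move=> w _; rewrite lee_fin /D.
  + by apply/measurable_EFinP; exact: (cylindrical_measurable_fun cD).
  + exact: emeasurable_funD.
  + move=> w _; rewrite -EFinD lee_fin -lerBlDl (le_trans _ (close w))//.
    by rewrite [leRHS]distrC; exact: lerB_dist.
Qed.

End stages.

(** * Mean distances of renormalized cascades *)

Section estimates.
Context {R : realType} {X : metricType R} (u : X -> R) (x0 : X).
Implicit Types (b : bool) (x y : X) (N n : nat).

Local Notation bmean := (mean (coin_bias u x0)).
Local Notation bias01 := (coin_bias01 u x0).

Definition stage_dist b N n x y : R := bmean (fun w =>
  `|cascade u b (- N%:Z) n x w - cascade u b (- N%:Z) n y w| / base_density u x0 b N w).

Lemma stage_distE b N n x y :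
  bmean (fun w => `|stage u x0 b N n x w - stage u x0 b N n y w|) =
  stage_dist b N n x y.
Proof.
congr (mean _ _); apply/funext => w; rewrite /stage -mulrBl normrM.
rewrite [X in _ * X]gtr0_norm ?invr_gt0 ?base_density_gt0//.
by congr (`|_| / _); rewrite opprB addrA subrK.
Qed.

Lemma cylindrical_stage_dist b N n x y : cylindrical (fun w =>
  `|cascade u b (- N%:Z) n x w - cascade u b (- N%:Z) n y w| / base_density u x0 b N w).
Proof.
apply: (cylindrical_comp2 (fun s t => s / t)); last exact: cylindrical_base.
by apply: (cylindrical_comp2 (fun s t => `|s - t|)); exact: cylindrical_cascade.
Qed.

Hypothesis hX : length_space X.
Variable L : R.
Hypothesis L0 : 0 <= L.
Hypothesis hu : forall x y, `|u x - u y| <= L * mdist x y.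

(** Two points at distance [d] are joined by a connected set within distance
    [2 d] of the first one, on which [u] deviates by at most [2 L d]. *)
Lemma stage_dist_local b N n x y :
  4 ^ (- N%:Z + n%:Z) * (2 * L * mdist x y) <= 4^-1 ->
  stage_dist b N n x y <= 8 * L * mdist x y.
Proof.
move=> small; have [->|xy] := eqVneq x y.
  rewrite mdistxx mulr0 -(mean_cst (coin_bias u x0) 0).
  rewrite /stage_dist (_ : (fun _ => _) = (fun=> 0)) ?lexx//.
  by apply/funext => w; rewrite subrr normr0 mul0r.
have d0 : 0 < mdist x y by rewrite mdist_gt0.
have [S [cS Sx Sy Sd]] := short_connected hX x y d0.
have Sr z : S z -> `|u x - u z| <= 2 * L * mdist x y.
  move=> /Sd xz; rewrite (le_trans (hu _ _))//.
  have : L * mdist x z <= L * (mdist x y + mdist x y) by rewrite ler_wpM2l.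
  by lra.
set r := 2 * L * mdist x y in small Sr.
pose B := base_density u x0 b N.
pose dens z w := density u b (- N%:Z) n z w / B w.
have cdens z : cylindrical (dens z).
  apply: (cylindrical_comp2 (fun s t => s / t)); last exact: cylindrical_base.
  exact: cylindrical_density.
have -> : 8 * L * mdist x y = bmean (fun w => 2 * r * dens x w + 2 * r * dens y w).
  rewrite meanD; [|exact: (cylindrical_comp ( *%R _))..].
  by rewrite !meanZ// !mean_density /r; ring.
apply: le_mean => //.
- exact: coin_bias01.
- exact: cylindrical_stage_dist.
- by apply: (cylindrical_comp2 (fun s t => 2 * r * s + 2 * r * t)).
move=> w; rewrite /dens.
rewrite (_ : _ + _ = (density u b (- N%:Z) n x w + density u b (- N%:Z) n y w) *
    (2 * r) / B w); last by ring.
rewrite ler_wpM2r ?invr_ge0 ?(ltW (base_density_gt0 _ _ _ _ _))//.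
by rewrite (cascade_local _ _ cS).
Qed.

Lemma stage_dist_le b N n x y : stage_dist b N n x y <= 8 * L * mdist x y.
Proof.
have e0 := @exp4_gt0 R (- N%:Z + n%:Z).
apply: (@locally_lipschitz _ _ hX (stage_dist b N n) (8 * L)
  (8 * (L + 1) * 4 ^ (- N%:Z + n%:Z))^-1).
- by rewrite mulr_ge0.
- by rewrite invr_gt0 !mulr_gt0// ltr_wpDl.
- move=> z; rewrite /stage_dist -[RHS](mean_cst (coin_bias u x0) 0).
  by congr (mean _ _); apply/funext => w; rewrite subrr normr0 mul0r.
- move=> z1 z2 z3; rewrite /stage_dist -meanD; [|exact: cylindrical_stage_dist..].
  apply: le_mean; [exact: coin_bias01|exact: cylindrical_stage_dist| |].
    by apply: (cylindrical_comp2 +%R); exact: cylindrical_stage_dist.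
  move=> w; rewrite -mulrDl ler_wpM2r ?invr_ge0 ?(ltW (base_density_gt0 _ _ _ _ _))//.
  exact: ler_distD.
move=> z1 z2 d; apply: stage_dist_local.
set E := 4 ^ _ in d e0 *.
have E0 : 0 < 8 * (L + 1) * E by rewrite !mulr_gt0// ltr_wpDl.
have : 8 * (L + 1) * E * mdist z1 z2 <= 1.
  by rewrite -ler_pdivlMl// mulr1 ltW.
have : 0 <= E * mdist z1 z2 by rewrite mulr_ge0 ?mdist_ge0// ltW.
by lra.
Qed.

Lemma selected_dist_le N n x y :
  bmean (fun w => `|stage u x0 (w selector) N n x w - stage u x0 (w selector) N n y w|)
    <= 16 * L * mdist x y.
Proof.
have cyl b : cylindrical (fun w => `|stage u x0 b N n x w - stage u x0 b N n y w|).
  by apply: (cylindrical_comp2 (fun s t => `|s - t|)); exact: cylindrical_stage.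
have -> : 16 * L * mdist x y = 8 * L * mdist x y + 8 * L * mdist x y by ring.
apply: le_trans (lerD (stage_dist_le true N n x y) (stage_dist_le false N n x y)).
rewrite -!stage_distE -meanD//; apply: le_mean; first exact: coin_bias01.
- by apply: (cylindrical_comp2 (fun s t => `|s - t|)); exact: cylindrical_selected.
- by apply: (cylindrical_comp2 +%R).
- by move=> w; case: (w selector); rewrite ?lerDl ?lerDr.
Qed.

(** The difference of the values at [x] and [y] is tested against the coin of the
    component of [x], on the event that the grid [b] is selected. *)
Lemma selected_dist_ge b N n j x y : - N%:Z <= j -> j < - N%:Z + n%:Z ->
  key u b j x != key u b j y ->
  tent b j (cell b j (u x)) (u x) / 2 <=
  bmean (fun w => `|stage u x0 (w selector) N n x w - stage u x0 (w selector) N n y w|).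
Proof.
move=> Nj jn xy.
pose k := key u b j x.
pose g w := (stage u x0 b N n x w - stage u x0 b N n y w) * sign w k : R.
have cg : cylindrical g.
  apply: (cylindrical_comp2 *%R); last exact: cylindrical_sign.
  by apply: (cylindrical_comp2 (fun s t => s - t)); exact: cylindrical_stage.
have gE : bmean g = tent b j (cell b j (u x)) (u x).
  have cz z : cylindrical (fun w =>
      cascade u b (- N%:Z) n z w * sign w k / base_density u x0 b N w).
    apply: (cylindrical_comp2 (fun s t => s / t)); last exact: cylindrical_base.
    apply: (cylindrical_comp2 *%R); first exact: cylindrical_cascade.
    exact: cylindrical_sign.
  transitivity (bmean (fun w =>
      cascade u b (- N%:Z) n x w * sign w k / base_density u x0 b N w -
      cascade u b (- N%:Z) n y w * sign w k / base_density u x0 b N w)).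
    by congr (mean _ _); apply/funext => w; rewrite /g /stage; ring.
  rewrite meanB// !mean_cascade_sign// jn eqxx.
  by rewrite [_ == key u b j x]eq_sym (negbTE xy) subr0.
pose h w : R := if w selector == b then g w else 0.
have cbit : cylindrical (fun w : key_type (X := X) -> bool => (w selector == b)).
  by apply: (cylindrical_comp (eq_op^~ b)); exact: cylindrical_coord.
have ch : cylindrical h.
  exact: (cylindrical_comp2 (fun (c : bool) s => if c then s else 0) cbit cg).
have -> : tent b j (cell b j (u x)) (u x) / 2 = bmean h.
  rewrite -gE mulrC -meanZ// -[RHS](mean_avg _ selector ch).
  congr (mean _ _); apply/funext => w; rewrite /avg /h /=.
  have gN c : g (upd w selector c) = g w.
    (* [selector] differs from all keys by computation. *)
    by [].
  rewrite !gN /upd eqxx; move: (g w) => t.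
  by case: (b) => /=; lra.
apply: le_mean => //; first exact: coin_bias01.
  by apply: (cylindrical_comp2 (fun s t => `|s - t|)); exact: cylindrical_selected.
move=> w; rewrite /h; case: eqP => [->|_]; last exact: normr_ge0.
by rewrite (le_trans (ler_norm _))// normrM abs_sign mulr1.
Qed.

(** A path from [x0] to [x] has bounded image under [u], and the cells around the
    origin exhaust the line. *)
Lemma absorbing x : exists N, absorbed u x0 x N.
Proof.
have [S [cS Sx0 Sx Sd]] := short_connected hX x0 x ltr01.
pose M := `|u x0| + L * (mdist x0 x + 1).
have SM z : S z -> `|u z| <= M.
  move=> /Sd xz; rewrite -[u z](subrK (u x0)) (le_trans (ler_normD _ _))//.
  rewrite addrC lerD2l distrC (le_trans (hu _ _))// ler_wpM2l//.
have M0 : 0 <= M by rewrite (le_trans _ (SM _ Sx)).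
pose N := Num.bound (3 * M).
have NM : 3 * M < 4 ^+ N.
  rewrite (lt_trans (archi_boundP _)) ?mulr_ge0// -natrX ltr_nat.
  exact: ltn_expl.
have cellE b z : S z -> cell b (- N%:Z) (u z) = -1.
  move=> Sz; apply/floor_def; rewrite /coord -exprnN.
  have : `|4 ^- N * u z| < 3^-1.
    rewrite normrM gtr0_norm ?invr_gt0 ?exprn_gt0// -ltr_pdivlMl ?invr_gt0 ?exprn_gt0//.
    by rewrite invrK (le_lt_trans (SM _ Sz))//; lra.
  by rewrite ltr_norml /theta /=; case: b; lra.
exists N => b; apply: (@key_connected _ _ _ _ _ _ _ S) => // z Sz.
by rewrite /level_set/= !cellE.
Qed.

End estimates.

(** * The bilipschitz embedding *)

Lemma scale_exists {R : realType} (t : R) : 0 < t ->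
  exists j : int, (4 ^ j)^-1 < t <= 4 * (4 ^ j)^-1.
Proof.
move=> t0.
have lt_exp4 (x : R) : 0 <= x -> exists n : nat, x < 4 ^+ n.
  move=> x0; exists (Num.bound x); rewrite (lt_trans (archi_boundP x0))//.
  by rewrite -natrX ltr_nat ltn_expl.
have [M Mt] := lt_exp4 _ (ltW (ltac:(by rewrite invr_gt0) : 0 < t^-1)).
have [k0 k0t] := lt_exp4 (t * 4 ^+ M) (ltac:(by rewrite mulr_ge0 ?exprn_ge0// ltW)).
have ex : exists k : nat, t * 4 ^+ M <= 4 ^+ k by exists k0; exact: ltW.
have tM : 1 < t * 4 ^+ M by rewrite -ltr_pdivrMl// mulr1.
case: (ex_minnP ex) => -[|k] tk mink; first by move: tk; rewrite expr0 leNgt tM.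
exists (M%:Z - k%:Z).
have E : (4 : R) ^ (M%:Z - k%:Z) = 4 ^+ M / 4 ^+ k by rewrite expfzDr// -exprnN.
have kt : 4 ^+ k < t * 4 ^+ M.
  by rewrite ltNge; apply/negP => /mink; rewrite ltnn.
have M0 : (0 : R) < 4 ^+ M by rewrite exprn_gt0.
rewrite E invf_div ltr_pdivrMr// kt/= mulrA ler_pdivlMr//.
by rewrite -exprS.
Qed.

Lemma cell_diam {R : realType} b j (t : R) : exists I : interval R,
  [set` I] = [set s | cell b j s = cell b j t] /\
  (diam ([set` I] : set R^o) <= ((4 ^ j)^-1)%:E)%E.
Proof.
have e0 := @exp4_gt0 R j.
set m := cell b j t.
pose lo : R := (m%:~R + theta b) / 4 ^ j.
pose hi : R := (m%:~R + 1 + theta b) / 4 ^ j.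
have hilo : hi - lo = (4 ^ j)^-1 by rewrite /hi /lo; ring.
have mem (s : R) : (lo <= s < hi) = (cell b j s == m).
  rewrite floor_eq intrD /coord /lo /hi ler_pdivrMr// ltr_pdivlMr//.
  by rewrite [s * _]mulrC lerBrDr ltrBlDr.
exists `[lo, hi[; split.
  by apply/seteqP; split => s /=; rewrite in_itv/= mem => /eqP.
apply: ge_ereal_sup => _ [[s s'] /= [+ +] <-]; rewrite !in_itv/= lee_fin.
move=> /andP[h1 h2] /andP[h3 h4].
by rewrite [leLHS](_ : _ = `|s' - s|)// -hilo ler_norml; apply/andP; split; lra.
Qed.

Theorem theorem1p1 (R : realType) (X : metricType R) (hX : length_space X)
    (u : X -> R^o) (hu : lipschitz_map u)
    (hC : exists2 C : R, 0 < C & forall (I : interval R) (x : X),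
       (u @^-1` [set` I]) x ->
       (diam (connected_component (u @^-1` [set` I]) x)
          <= C%:E * diam ([set` I] : set R^o))%E) :
  exists (d : measure_display) (Z : measurableType d)
         (mu : {measure set Z -> \bar R}) (f : X -> LspaceType1 mu),
    bilipschitz_embedding f.
Proof.
have [L L0 uL] := hu; have {hC} [C C0 hC] := hC.
have [[x0 _]|noX] := pselect (exists x : X, True); last first.
  exists _, _, (@lebesgue_measure R), (fun x => False_rect _ (noX (ex_intro _ x I))).
  by exists 1 => // x; have := noX (ex_intro _ x I).
pose v : X -> R := u.
have vL x y : `|v x - v y| <= L * mdist x y by rewrite distrC; exact: uL.
have key_dist b (j : int) x y : key v b j x = key v b j y -> mdist x y <= C / 4 ^ j.
  move=> /key_component xy; have [J [JE diamJ]] := @cell_diam R b j (v x).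
  have Jx : level_set v b j x = u @^-1` [set` J] by rewrite JE.
  have := hC J x; rewrite -Jx => /(_ erefl) diamX.
  rewrite -lee_fin EFinM.
  apply: (@le_trans _ _ (diam (connected_component (level_set v b j x) x))).
    apply: ereal_sup_ubound; exists (x, y) => //=; split => //.
    exact: connected_component_refl.
  by apply: (le_trans diamX); rewrite lee_pmul2l ?lte_fin.
have absX := absorbing x0 hX L0 vL.
pose mu := coin_measure (coin_bias01 v x0).
have /choice[F Fae] x := L1_class (integrable_embed absX x).
(* The scale [j] below satisfies [mdist x y <= 4 * C * 4 ^ - j], the tent is at
   least [4 ^ - j / 12] in one of the grids, and this grid is selected with
   probability [1 / 2]: hence the constant [96 * C]. *)
exists _, _, mu, F, (1 + 16 * L + 96 * C).
  by rewrite -addrA lerDl addr_ge0// mulr_ge0// ltW.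
move=> x y.
pose D : \bar R := (\int[mu]_w `|embed v x0 x w - embed v x0 y w|%:E)%E.
have FD : mdist (F x) (F y) = fine D.
  by apply: mdist_L1 => //; exact: measurable_embed.
pose M N n := mean (coin_bias v x0) (fun w =>
  `|stage v x0 (w selector) N n x w - stage v x0 (w selector) N n y w|).
have DM N n : (depth v x0 x <= N)%N -> (depth v x0 y <= N)%N ->
    M N n - 4 * 8 ^+ N / 2 ^+ n <= fine D <= M N n + 4 * 8 ^+ N / 2 ^+ n.
  move=> xN yN; have /andP[] := integral_embed_close absX n xN yN.
  rewrite -/D -/(M N n); case: (D) => [r| |] //=.
  by rewrite !lee_fin => -> ->.
have small N e : 0 < e -> exists n0, forall n, (n0 <= n)%N ->
    4 * 8 ^+ N / 2 ^+ n <= e :> R.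
  move=> e0; exists (Num.bound (4 * 8 ^+ N / e)) => n n0n.
  rewrite ler_pdivrMr ?exprn_gt0// [e * _]mulrC -ler_pdivrMr//.
  have A0 : 0 <= 4 * 8 ^+ N / e by rewrite divr_ge0 ?mulr_ge0 ?exprn_ge0// ltW.
  apply: le_trans (ltW (archi_boundP A0)) _.
  by rewrite -(natrX _ 2 n) ler_nat (leq_trans n0n)// ltnW// ltn_expl.
have upper : fine D <= 16 * L * mdist x y.
  apply/ler_addgt0Pr => e e0.
  pose N := maxn (depth v x0 x) (depth v x0 y).
  have [n0 /(_ n0 (leqnn _)) ne] := small N e e0.
  have /andP[_] := DM N n0 (leq_maxl _ _) (leq_maxr _ _).
  by move=> /le_trans; apply; rewrite lerD// selected_dist_le.
have lower : mdist x y / (96 * C) <= fine D.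
  have [->|xy] := eqVneq x y.
    by rewrite mdistxx mul0r fine_ge0// integral_ge0.
  have d0 : 0 < mdist x y by rewrite mdist_gt0.
  have [j /andP[j1 j2]] := scale_exists (divr_gt0 d0 C0).
  have [b tb] := @tent_large R j (v x).
  have keyxy : key v b j x != key v b j y.
    apply/eqP => /key_dist; rewrite leNgt => /negP; apply.
    by rewrite mulrC -ltr_pdivlMr.
  apply/ler_addgt0Pr => e e0.
  pose N := maxn `|j|%N (maxn (depth v x0 x) (depth v x0 y)).
  have [n0 ne] := small N e e0.
  pose n := maxn n0 (N + `|j|%N).+1.
  have jN : (`|j| <= N)%N by exact: leq_maxl.
  have Nn : (N + `|j| < n)%N by exact: leq_maxr.
  have Nj : - N%:Z <= j by clear -jN; lia.
  have jn : j < - N%:Z + n%:Z by clear -Nn; lia.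
  have /andP[DMn _] := DM N n (leq_trans (leq_maxl _ _) (leq_maxr _ _))
    (leq_trans (leq_maxr _ _) (leq_maxr _ _)).
  apply: (@le_trans _ _ (M N n)); last first.
    by rewrite -lerBlDr (le_trans _ DMn)// lerD2l lerN2 ne// leq_maxl.
  apply: le_trans (selected_dist_ge x0 Nj jn keyxy).
  move: j2 tb; rewrite invfM; set T := tent _ _ _ _.
  move: (mdist x y) (4 ^ j)^-1 T => d E T; clear -C0 => dE ET.
  rewrite invfM mulrA [d / 96]mulrC -mulrA; lra.
rewrite FD; apply/andP; split.
  apply: le_trans lower; rewrite mulrC ler_wpM2l ?mdist_ge0//.
  by rewrite lef_pV2 ?posrE; nra.
apply: le_trans upper _; rewrite ler_wpM2r ?mdist_ge0//; nra.
Qed.
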